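(* The freeness problem for braids from $B_5$ is undecidable: there is no algorithm which, given a finite set $B \subseteq B_5$ of braids, decides whether the semigroup $\langle B \rangle$ is free.
   Context: $B_5$ is the braid group on five strands, with generators $\sigma_1,\dots,\sigma_4$ and relations $\sigma_i\sigma_j = \sigma_j\sigma_i$ for $|i-j|\ge 2$ and $\sigma_i\sigma_{i+1}\sigma_i = \sigma_{i+1}\sigma_i\sigma_{i+1}$ for $1 \le i \le 3$; braids are given as words over the generators and their inverses. For a finite set $B$ of braids, $\langle B \rangle$ is the semigroup of all nonempty finite products of elements of $B$; it is free (on $B$) if any two different finite sequences of generators from $B$ yield different elements of $B_5$. *)

(* Defs.v *)
(* MathComp world, with the classical axioms of mathcomp.classical.boolp
   (used to form the quotient of words by the braid relations). *)
From HB Require Import structures.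
From mathcomp Require Import all_boot.
From mathcomp Require Import finmap boolp.

Set Implicit Arguments.
Unset Strict Implicit.
Unset Printing Implicit Defensive.

(* The letter (i, true) is the generator sigma_{i+1}, and (i, false) is its
   inverse. *)
Definition braid_letter (n : nat) : Type := ('I_n.-1 * bool)%type.
Definition braid_word (n : nat) : Type := seq (braid_letter n).

HB.instance Definition _ n := Choice.on (braid_letter n).
HB.instance Definition _ n := Choice.on (braid_word n).

(* Equality of words in the group presented by Artin's generators and
   relations. *)
Inductive braid_eq (n : nat) : braid_word n -> braid_word n -> Prop :=
| braid_eq_refl u : braid_eq u u
| braid_eq_sym u v : braid_eq u v -> braid_eq v u
| braid_eq_trans u v w : braid_eq u v -> braid_eq v w -> braid_eq u w
| braid_eq_cat u u' v v' :
    braid_eq u u' -> braid_eq v v' -> braid_eq (u ++ v) (u' ++ v')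
| braid_eq_cancel (i : 'I_n.-1) (b : bool) :
    braid_eq [:: (i, b); (i, ~~ b)] [::]
| braid_eq_far (i j : 'I_n.-1) :
    i.+2 <= j ->
    braid_eq [:: (i, true); (j, true)] [:: (j, true); (i, true)]
| braid_eq_braid (i j : 'I_n.-1) :
    j = i.+1 :> nat ->
    braid_eq [:: (i, true); (j, true); (i, true)]
             [:: (j, true); (i, true); (j, true)].

Definition braid_eqb (n : nat) (u v : braid_word n) : bool :=
  `[< braid_eq u v >].

Lemma braid_eqb_equiv n : equiv_class_of (@braid_eqb n).
Proof.
split=> [u | u v | v u w /asboolP uv /asboolP vw].
- exact/asboolP/braid_eq_refl.
- by apply/asboolP/asboolP; exact: braid_eq_sym.
- by apply/asboolP; exact: braid_eq_trans uv vw.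
Qed.

Canonical braid_equiv n := EquivRelPack (@braid_eqb_equiv n).

Definition braid (n : nat) : Type := {eq_quot @braid_equiv n}%qT.

HB.instance Definition _ n := Choice.on (braid n).
HB.instance Definition _ n := EqQuotient.on (braid n).

Definition braid_of (n : nat) (w : braid_word n) : braid n := (\pi w)%qT.

Definition word_inv (n : nat) (w : braid_word n) : braid_word n :=
  rev [seq (x.1, ~~ x.2) | x <- w].

Section BraidGroup.
Variable n : nat.
Implicit Types (u v w : braid_word n) (x y z : braid n).

Lemma braid_ofP u v : braid_of u = braid_of v <-> braid_eq u v.
Proof.
rewrite /braid_of; split=> [/eqP | uv].
  by rewrite eqmodE => /asboolP.
by apply/eqP; rewrite eqmodE; apply/asboolP.
Qed.

Definition braid_mul x y : braid n := braid_of (repr x ++ repr y).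
Definition braid_one : braid n := braid_of [::].
Definition braid_inv x : braid n := braid_of (word_inv (repr x)).

Lemma braid_ofK x : braid_of (repr x) = x.
Proof. exact: reprK. Qed.

Lemma repr_braid_of u : braid_eq (repr (braid_of u)) u.
Proof. by apply/braid_ofP; rewrite braid_ofK. Qed.

Lemma braid_of_cat u v :
  braid_of (u ++ v) = braid_mul (braid_of u) (braid_of v).
Proof.
apply/braid_ofP; apply: braid_eq_cat;
  by apply: braid_eq_sym; exact: repr_braid_of.
Qed.

Lemma braid_eq_wordV u : braid_eq (u ++ word_inv u) [::].
Proof.
elim: u => [|[i b] u IHu]; first exact: braid_eq_refl.
rewrite /word_inv /= rev_cons -cats1 -/(word_inv u) catA.
apply: braid_eq_trans (braid_eq_cancel i b).
rewrite -cat1s -[in X in braid_eq _ X]cat1s.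
apply: (braid_eq_cat (braid_eq_refl [:: (i, b)])).
rewrite -[X in braid_eq _ X]cat0s.
exact: braid_eq_cat IHu (braid_eq_refl _).
Qed.

Lemma word_invK : involutive (@word_inv n).
Proof.
move=> u; rewrite /word_inv map_rev revK -map_comp map_id_in // => -[i b] _ /=.
by rewrite negbK.
Qed.

Lemma braid_mulA : associative braid_mul.
Proof.
move=> x y z; rewrite -(braid_ofK x) -(braid_ofK y) -(braid_ofK z).
by rewrite -!braid_of_cat catA.
Qed.

Lemma braid_mul1 : left_id braid_one braid_mul.
Proof. by move=> x; rewrite -(braid_ofK x) -braid_of_cat. Qed.

Lemma braid_mulr1 : right_id braid_one braid_mul.
Proof. by move=> x; rewrite -(braid_ofK x) -braid_of_cat cats0. Qed.

Lemma braid_mulV : left_inverse braid_one braid_inv braid_mul.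
Proof.
move=> x; rewrite -{2}(braid_ofK x) -braid_of_cat; apply/braid_ofP.
by rewrite -{2}(word_invK (repr x)); exact: braid_eq_wordV.
Qed.

Lemma braid_mulrV : right_inverse braid_one braid_inv braid_mul.
Proof.
move=> x; rewrite -{1}(braid_ofK x) -braid_of_cat; apply/braid_ofP.
exact: braid_eq_wordV.
Qed.

End BraidGroup.

HB.instance Definition _ n := isGroup.Build (braid n)
  (@braid_mulA n) (@braid_mul1 n) (@braid_mulr1 n)
  (@braid_mulV n) (@braid_mulrV n).

(* The semigroup generated by B is free on B. *)
Definition free_semigroup (G : groupType) (B : {fset G}) : Prop :=
  forall s t : seq G,
    s != [::] -> t != [::] ->
    {subset s <= B} -> {subset t <= B} ->
    (\prod_(x <- s) x = \prod_(x <- t) x)%g -> s = t.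

(* Model of computation: the weak call-by-value lambda-calculus, a
   Turing-complete deterministic fragment of the lambda-calculus. Terms are in
   de Bruijn notation. *)
Inductive term : Type :=
| var of nat
| app of term & term
| lam of term.

Fixpoint closed_at (k : nat) (s : term) : bool :=
  match s with
  | var i => i < k
  | app s1 s2 => closed_at k s1 && closed_at k s2
  | lam s1 => closed_at k.+1 s1
  end.

Definition closed (s : term) : bool := closed_at 0 s.

(* Replaces the variable k of s by u. No lifting is needed since u is always
   closed when a closed program is evaluated. *)
Fixpoint subst (u : term) (k : nat) (s : term) : term :=
  match s with
  | var i => if i == k then u else var i
  | app s1 s2 => app (subst u k s1) (subst u k s2)
  | lam s1 => lam (subst u k.+1 s1)
  end.

Inductive eval : term -> term -> Prop :=
| eval_lam s : eval (lam s) (lam s)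
| eval_app s t s' v w :
    eval s (lam s') -> eval t v -> eval (subst v 0 s') w ->
    eval (app s t) w.

(* Inputs and outputs are Scott-encoded; all the encodings are closed
   abstractions. *)
Definition enc_bool (b : bool) : term :=
  lam (lam (var (if b then 1 else 0))).

Fixpoint enc_nat (m : nat) : term :=
  match m with
  | 0 => lam (lam (var 1))
  | m'.+1 => lam (lam (app (var 0) (enc_nat m')))
  end.

Definition enc_pair (s t : term) : term := lam (app (app (var 0) s) t).

Fixpoint enc_seq (X : Type) (enc : X -> term) (xs : seq X) : term :=
  match xs with
  | [::] => lam (lam (var 1))
  | x :: xs' => lam (lam (app (app (var 0) (enc x)) (enc_seq enc xs')))
  end.

Definition enc_letter (n : nat) (x : braid_letter n) : term :=
  enc_pair (enc_nat x.1) (enc_bool x.2).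

Definition enc_braid_words (n : nat) : seq (braid_word n) -> term :=
  enc_seq (enc_seq (@enc_letter n)).

(* The program D terminates on every input and answers whether P holds. *)
Definition decides (X : Type) (enc : X -> term) (P : X -> Prop) (D : term) :
    Prop :=
  forall x : X,
    (P x -> eval (app D (enc x)) (enc_bool true)) /\
    (~ P x -> eval (app D (enc x)) (enc_bool false)).

Definition algorithmically_decidable
    (X : Type) (enc : X -> term) (P : X -> Prop) : Prop :=
  exists2 D : term, closed D & decides enc P D.

(* Main.v *)
(* The braids on the strands 1 to 3 and the braids moving the strands 4, 5 and
   the bundle of the strands 1 to 3 commute, so B_5 contains a direct product of
   two free monoids of rank 2, hence all pairs of words.  For a rewriting system
   with rules l v -> v r and a start word u0, consider, as in the undecidability
   proof for the mixed modification of the Post correspondence problem, the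
   pairs (a, h(a)) and (a, g(a)), where h writes r with separators in front of
   the letters and g writes l with separators after the letters.  Two distinct
   products can only agree if, from their first difference on, one of them uses
   h and the other one uses g and lags behind, so that the unmatched word is
   rewritten by the rules; thus the pairs fail to form a code iff u0 can be
   rewritten to the halting letter.

   Such rules simulate a machine whose configuration is a circular word with a
   single state letter, so a register machine that reads its input once, and the
   latter evaluates lambda-terms with closures and a stack coded by the Cantor
   pairing.  Given a decision procedure D, let the machine transform its input
   into a list of braids and apply D to it.  Only one of the pairs depends on
   the input, and it is a concatenation of fixed words, one for each symbol of
   the input; hence the machine can build this pair while it reads the
   description of all the other pairs.  On this input it applies D to exactly
   the set of braids that says whether it accepts, and it accepts iff D answers
   that this set is free, whereas the set is free iff it does not accept. *)
From HB Require Import structures.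
Require Import Defs.
From mathcomp Require Import all_boot all_algebra.
From mathcomp Require Import finmap boolp zify.

Set Implicit Arguments.
Unset Strict Implicit.
Unset Printing Implicit Defensive.

(** * Pairs of words as braids *)

Definition twist (k : nat) (b : bool) (p : int * int) : int * int :=
  (match k, b with
  | 0, true => (p.1 + p.2, p.2)
  | 0, false => (p.1 - p.2, p.2)
  | _, true => (p.1, p.2 - p.1)
  | _, false => (p.1, p.2 + p.1)
  end)%R.

Definition swap_bits (i : nat) (bs : seq bool) : seq bool :=
  set_nth false (set_nth false bs i (nth false bs i.+1)) i.+1 (nth false bs i).

(* Forgets the strands outside bs, then lets the remaining three-strand braid
   act on Z^2 through B_3 -> SL_2(Z). *)
Definition act (st : seq bool * (int * int)) (l : braid_letter 5) :=
  let: (bs, p) := st in let: (i, b) := l in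
  (swap_bits i bs,
   if nth false bs i && nth false bs i.+1
   then twist (count id (take i bs)) b p else p).

Definition act_word := foldl act.

Definition three_of_five (bs : seq bool) :=
  (size bs == 5) && (count id bs == 3).

Lemma act_three st l : three_of_five st.1 -> three_of_five (act st l).1.
Proof.
case: st => bs p; case: l => -[i i4] b /=.
case: bs => [//|b0 [//|b1 [//|b2 [//|b3 [//|b4 [|//]]]]]].
by case: i i4 => [|[|[|[|//]]]] i4; case: b0 b1 b2 b3 b4 => [] [] [] [] [].
Qed.

Lemma act_word_three st w :
  three_of_five st.1 -> three_of_five (act_word st w).1.
Proof. by elim: w st => //= l w IHw st st3; apply/IHw/act_three. Qed.

(** Among three kept strands at most one lies to the left of a crossing of two kept ones, so [twist]
    is only called with 0 or 1, where its matrices satisfy the relations of B_3. What remains is a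
    finite check over the positions of the kept strands. *)
Lemma act_word_eq u v : braid_eq u v ->
  forall st, three_of_five st.1 -> act_word st u = act_word st v.
Proof.
elim=> {u v} //.
- by move=> u v _ IHu st st3; rewrite IHu.
- by move=> u v w _ IHu _ IHv st st3; rewrite IHu // IHv.
- move=> u u' v v' _ IHu _ IHv st st3.
  by rewrite /act_word !foldl_cat -/act_word IHu // IHv // act_word_three.
- move=> [i i4] b [bs [x y]].
  case: bs => [//|b0 [//|b1 [//|b2 [//|b3 [//|b4 [|//]]]]]].
  case: i i4 => [|[|[|[|//]]]] i4;
    case: b b0 b1 b2 b3 b4 => [] [] [] [] [] [] //= _;
    by rewrite /act /twist /=; congr (_, (_, _)); lia.
- move=> [i i4] [j j4] ij [bs [x y]].
  case: bs => [//|b0 [//|b1 [//|b2 [//|b3 [//|b4 [|//]]]]]].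
  case: i i4 ij => [|[|[|[|//]]]] i4; case: j j4 => [|[|[|[|//]]]] j4 //= _;
  by case: b0 b1 b2 b3 b4 => [] [] [] [] [].
- move=> [i i4] [j j4] ij [bs [x y]].
  case: bs => [//|b0 [//|b1 [//|b2 [//|b3 [//|b4 [|//]]]]]].
  case: i i4 ij => [|[|[|[|//]]]] i4; case: j j4 => [|[|[|[|//]]]] j4 //= _;
    case: b0 b1 b2 b3 b4 => [] [] [] [] [] //= _;
    by rewrite /act /twist /=; congr (_, (_, _)); lia.
Qed.

(* [low] braids the strands 1 to 3 and [high] the strands 4, 5 and the bundle
   of the strands 1 to 3; thus they generate two commuting free monoids.  The
   signs make all the matrices in [act] nonnegative. *)
Definition sig (i : nat) (b : bool) : braid_letter 5 := (inord i, b).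

Definition low (b : bool) : braid_word 5 :=
  if b then [:: sig 1 false; sig 1 false] else [:: sig 0 true; sig 0 true].

Definition high (b : bool) : braid_word 5 :=
  if b then [seq sig i true | i <- [:: 2; 1; 0; 0; 1; 2]]
  else [:: sig 3 false; sig 3 false].

Definition bits_word (p : seq bool * seq bool) : braid_word 5 :=
  flatten (map low p.1) ++ flatten (map high p.2).

Definition grow (p : int * int) (b : bool) : int * int :=
  (if b then (p.1, p.2 + p.1 + p.1) else (p.1 + p.2 + p.2, p.2))%R.

Definition low_strands := [:: true; true; true; false; false].
Definition high_strands := [:: true; false; false; true; true].

Lemma act_low s p : act_word (low_strands, p) (flatten (map low s)) =
  (low_strands, foldl grow p s).
Proof.
elim: s p => //= b s IHs p; rewrite /act_word foldl_cat -IHs.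
by congr foldl; case: b p => -[x y]; rewrite /= !inordK.
Qed.

(** In [high] no two of the strands 1 to 3 cross and every strand returns to its place. Dually, in
    [low] no two of the strands 1, 4, 5 cross. *)
Lemma act_low_high s p : act_word (low_strands, p) (flatten (map high s)) =
  (low_strands, p).
Proof.
elim: s p => //= b s IHs p; rewrite /act_word foldl_cat -[RHS]IHs.
by congr foldl; case: b p => -[x y]; rewrite /= !inordK.
Qed.

Lemma act_high_low s p : act_word (high_strands, p) (flatten (map low s)) =
  (high_strands, p).
Proof.
elim: s p => //= b s IHs p; rewrite /act_word foldl_cat -[RHS]IHs.
by congr foldl; case: b p => -[x y]; rewrite /= !inordK.
Qed.

(** Once the strands 2 and 3 are forgotten, the bit true, a loop around the bundle, becomes a power
    of the first generator of B_3, and false one of the second. In [low] it is the other way round,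
    whence [negb]. *)
Lemma act_high s p : act_word (high_strands, p) (flatten (map high s)) =
  (high_strands, foldl grow p (map negb s)).
Proof.
elim: s p => //= b s IHs p; rewrite /act_word foldl_cat -IHs.
by congr foldl; case: b p => -[x y]; rewrite /= !inordK.
Qed.

(** Ping-pong: the entries stay positive, so the last bit can be read off from which entry is
    larger, and the entries are equal only at the start. *)
Lemma grow_inj s t : foldl grow (1, 1)%R s = foldl grow (1, 1)%R t -> s = t.
Proof.
have pos u : (let p := foldl grow (1, 1) u in 0 < p.1 /\ 0 < p.2)%R.
  elim/last_ind: u => //= u b; rewrite foldl_rcons.
  by case: (foldl _ _ _) b => [x y] [] /=; lia.
elim/last_ind: s t => [|s b IHs] t; elim/last_ind: t => [//|t c _];
  rewrite !foldl_rcons.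
- by case: (foldl _ _ t) (pos t) c => x y /= ? [] []; lia.
- by case: (foldl _ _ s) (pos s) b => x y /= ? [] []; lia.
move=> eq_st; have: b = c /\ foldl grow (1, 1)%R s = foldl grow (1, 1)%R t.
  case: (foldl _ _ s) (foldl _ _ t) (pos s) (pos t) eq_st => [x y] [z w] /=.
  by case: b c => [] [] /= ? ? [] ? ?; split=> //; try congr pair; lia.
by case=> -> /IHs ->.
Qed.

Lemma bits_word_inj p q :
  braid_of (bits_word p) = braid_of (bits_word q) -> p = q.
Proof.
case: p q => [s t] [s' t'] /braid_ofP/act_word_eq pq.
have := pq (low_strands, (1, 1)%R) isT; have := pq (high_strands, (1, 1)%R) isT.
rewrite /bits_word /act_word !foldl_cat -/act_word.
rewrite !act_low !act_low_high !act_high_low !act_high /=.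
by move=> -[/grow_inj/(inj_map negb_inj) ->] [/grow_inj ->].
Qed.

Lemma braid_ofM n (u v : braid_word n) :
  braid_of (u ++ v) = (braid_of u * braid_of v)%g.
Proof. exact: braid_of_cat. Qed.

Lemma braid_of_flatten n (ws : seq (braid_word n)) :
  braid_of (flatten ws) = (\prod_(w <- ws) braid_of w)%g.
Proof. by elim: ws => [|w ws IHws];
  rewrite ?big_nil // big_cons -IHws -braid_ofM. Qed.

Lemma braid_of_sigV i :
  (braid_of [:: sig i false] = (braid_of [:: sig i true])^-1)%g.
Proof.
apply: (mulgI (braid_of [:: sig i true])); rewrite mulgV -braid_ofM.
by apply/braid_ofP; apply: (@braid_eq_cancel 5).
Qed.

(** For the first three generators, [r] moves the strand 4 once around the strands 1 to 3 and thus
    commutes with every braid of these. *)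
Lemma braid_ring_commute (G : groupType) (a b c : G) :
  (a * b * a = b * a * b -> b * c * b = c * b * c -> commute a c ->
   let r := c * b * a * a * b * c in commute a r /\ commute b r)%g.
Proof.
move=> aba bcb ac /=; rewrite /commute.
have abaz z : (a * (b * (a * z)) = b * (a * (b * z)))%g by rewrite !mulgA aba.
have bcbz z : (b * (c * (b * z)) = c * (b * (c * z)))%g by rewrite !mulgA bcb.
have acz z : (a * (c * z) = c * (a * z))%g by rewrite !mulgA ac.
rewrite -!mulgA; split.
- by rewrite acz abaz -(abaz c) ac.
- by rewrite bcbz -!acz (mulgA c b c) -bcb -!mulgA.
Qed.

Lemma low_high_commute b c :
  commute (braid_of (low b)) (braid_of (high c)).
Proof.
pose x i := braid_of [:: sig i true].
have cons l w : braid_of (l :: w) = (braid_of [:: l] * braid_of w)%g.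
  by rewrite -braid_ofM.
have far i j : i.+2 <= j < 4 -> commute (x i) (x j).
  move=> /andP[ij j4]; rewrite /commute -!braid_ofM; apply/braid_ofP.
  by apply: (@braid_eq_far 5 (inord i) (inord j)); rewrite !inordK //; lia.
have braid i : i.+1 < 4 -> (x i * x i.+1 * x i = x i.+1 * x i * x i.+1)%g.
  move=> i3; rewrite /x -!(braid_ofM [:: _] [:: _]) -!(braid_ofM [:: _; _]).
  apply/braid_ofP.
  by apply: (@braid_eq_braid 5 (inord i) (inord i.+1)); rewrite !inordK //; lia.
have com i : i < 2 -> commute (x i) (braid_of (high c)).
  case: c => i2; last first.
    rewrite /= -[_ :: _]cat1s braid_ofM !braid_of_sigV.
    have /commuteV xi3 : commute (x i) (x 3) by apply: far; lia.
    exact: commuteM.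
  have -> : braid_of (high true) =
      (x 2 * x 1%N * x 0 * x 0 * x 1%N * x 2)%g.
    rewrite /x -!mulgA; do 5! [rewrite /= cons; congr (_ * _)%g].
  have [] := braid_ring_commute (braid 0 isT) (braid 1 isT) (far 0 2 isT).
  by case: i i2 => [|[|//]].
case: b; rewrite /= -[_ :: _]cat1s braid_ofM ?braid_of_sigV; apply: commute_sym.
- by apply: commuteM; apply/commuteV/commute_sym/com.
- by apply: commuteM; apply/commute_sym/com.
Qed.

Lemma bits_word_cat s t s' t' :
  (braid_of (bits_word (s ++ s', t ++ t')) =
   braid_of (bits_word (s, t)) * braid_of (bits_word (s', t')))%g.
Proof.
rewrite /bits_word /= !map_cat !flatten_cat !braid_ofM !mulgA.
congr (_ * _)%g; rewrite -!mulgA; congr (_ * _)%g; rewrite !braid_of_flatten.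
rewrite !big_map; apply: commute_prod => c _; apply: commute_sym.
by apply: commute_prod => b _; exact/commute_sym/low_high_commute.
Qed.

(** * Binary coding of words over the naturals, and freeness as a code property *)

Definition nat_bits (n : nat) : seq bool := rcons (nseq n false) true.

Definition word_bits (w : seq nat) : seq bool := flatten (map nat_bits w).

Lemma word_bits_cat u v : word_bits (u ++ v) = word_bits u ++ word_bits v.
Proof. by rewrite /word_bits map_cat flatten_cat. Qed.

Lemma word_bits_inj : injective word_bits.
Proof.
have nb m n u v : nat_bits m ++ u = nat_bits n ++ v -> m = n /\ u = v.
  elim: m n => [|m IHm] [|n] //= [] //.
  by move=> /IHm[-> ->].
elim=> [|m u IHu] [|n v] //.
- by rewrite /word_bits /=; case: n.
- by rewrite /word_bits /=; case: m.
- by rewrite /word_bits /= => /nb[-> /IHu ->].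
Qed.

Definition pair_word (p : seq nat * seq nat) : braid_word 5 :=
  bits_word (word_bits p.1, word_bits p.2).

Lemma pair_word_prod (ps : seq (seq nat * seq nat)) :
  (\prod_(p <- ps) braid_of (pair_word p) =
   braid_of (pair_word (flatten (unzip1 ps), flatten (unzip2 ps))))%g.
Proof.
elim: ps => [|[u v] ps IHps]; first by rewrite big_nil.
by rewrite big_cons IHps /pair_word /= !word_bits_cat bits_word_cat.
Qed.

Lemma pair_word_inj p q : braid_of (pair_word p) = braid_of (pair_word q) ->
  p = q.
Proof.
by case: p q => [u v] [u' v'] /bits_word_inj[/word_bits_inj ->
  /word_bits_inj ->].
Qed.

Definition is_code (P : seq (seq nat * seq nat)) : Prop :=
  forall ps qs, ps != [::] -> qs != [::] ->
    {subset ps <= P} -> {subset qs <= P} ->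
    flatten (unzip1 ps) = flatten (unzip1 qs) ->
    flatten (unzip2 ps) = flatten (unzip2 qs) -> ps = qs.

(** [pair_word] induces an injective morphism from pairs of words, multiplied componentwise, to B_5;
    so sequences of generators with equal products correspond to sequences of pairs with equal
    concatenations. *)
Lemma free_pair_words (P : seq (seq nat * seq nat)) :
  free_semigroup [fset braid_of w | w in map pair_word P]%fset <-> is_code P.
Proof.
pose b p := braid_of (pair_word p).
have b_inj : injective b by exact: pair_word_inj.
have lift (s : seq (braid 5)) :
    {subset s <= [fset braid_of w | w in map pair_word P]%fset} ->
    exists2 ps, {subset ps <= P} & s = map b ps.
  elim: s => [|x s IHs] sP; first by exists [::].
  have [|ps psP ->] := IHs; first by move=> y ys; rewrite sP ?inE ?ys ?orbT.
  have /imfsetP[/= w /mapP[p pP ->] ->] := sP x (mem_head _ _).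
  by exists (p :: ps) => // q; rewrite inE => /predU1P[->|/psP].
have prodb ps : (\prod_(x <- map b ps) x = b (flatten (unzip1 ps),
  flatten (unzip2 ps)))%g.
  by rewrite big_map pair_word_prod.
split=> [free ps qs ps0 qs0 psP qsP eq1 eq2 | inj s t + + /lift[ps psP Es]
  /lift[qs qsP Et]].
- have sub rs : {subset rs <= P} ->
      {subset map b rs <= [fset braid_of w | w in map pair_word P]%fset}.
    by move=> rsP _ /mapP[r /rsP rP ->]; apply/imfsetP; exists (pair_word r);
      rewrite ?map_f.
  apply: (inj_map b_inj); apply: free; try exact: sub.
  + by move: ps0; case: (ps).
  + by move: qs0; case: (qs).
  + by rewrite !prodb eq1 eq2.
- rewrite {}Es {}Et => ps0 qs0; rewrite !prodb => /b_inj[eq1 eq2].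
  by rewrite (inj ps qs) //; [move: ps0; case: (ps) | move: qs0; case: (qs)].
Qed.

(** * Tiles *)

Definition sep_before (w : seq nat) : seq nat :=
  flatten [seq [:: 0; c] | c <- w].
Definition sep_after (w : seq nat) : seq nat :=
  flatten [seq [:: c; 0] | c <- w].

(** What the leading side of a partial match has written in excess when the unmatched word is [u]:
    separators occur only between letters, since the first 0 is already matched and the last one not
    yet written. *)
Definition pending (u : seq nat) : seq nat :=
  if u is c :: u' then c :: sep_before u' else [::].

Lemma sep_before_cat u v : sep_before (u ++ v) = sep_before u ++ sep_before v.
Proof. by rewrite /sep_before map_cat flatten_cat. Qed.

Lemma sep_before_pending u : u != [::] -> sep_before u = 0 :: pending u.
Proof. by case: u. Qed.

Lemma pending_cat u v : u != [::] ->
  pending (u ++ v) = pending u ++ sep_before v.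
Proof. by case: u => //= c u _; rewrite sep_before_cat. Qed.

Lemma pending_cat_sep u v : v != [::] ->
  pending (u ++ v) = sep_after u ++ pending v.
Proof.
move=> v0; elim: u => [|c u IHu] //=.
by rewrite sep_before_pending ?IHu //; case: (u) v0.
Qed.

Lemma sep_after_pending l u x z : size l < size u ->
  sep_after l ++ z = pending u ++ x ->
  exists2 v, u = l ++ v & z = pending v ++ x.
Proof.
elim: l u => [|a l IHl] [|c u] //=; first by exists (c :: u).
rewrite ltnS => lu; rewrite (@sep_before_pending u); last by case: (u) lu.
by case=> -> /(IHl _ lu)[v -> ->]; exists v.
Qed.

(** If [l] used up all of [u], its final separator would face the nonzero letter [c]. *)
Lemma sep_after_blocked l u c x z : u != [::] -> c != 0 ->
    sep_after l ++ z = pending u ++ c :: x ->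
  exists v, [/\ u = l ++ v, v != [::] & z = pending v ++ c :: x].
Proof.
move=> + c0; elim: l u => [|a l IHl] [|b u] //= _; first by exists (b :: u).
case: u => [|b' u] [->] /= => [c_eq0 | ]; first by rewrite -c_eq0 in c0.
by case/(IHl (b' :: u) isT) => v [-> v0 ->]; exists v.
Qed.

Lemma cat_neq0l (T : eqType) (u v : seq T) : u != [::] -> u ++ v != [::].
Proof. by rewrite -!size_eq0 size_cat; lia. Qed.

Lemma cat_neq0r (T : eqType) (u v : seq T) : v != [::] -> u ++ v != [::].
Proof. by rewrite -!size_eq0 size_cat; lia. Qed.

Definition flat (ps : seq (seq nat * seq nat)) := flatten (unzip2 ps).

Section Tiles.

Variables (rules : seq (seq nat * seq nat)) (u0 : seq nat) (halt : nat).

(* 0 is the separator, 1 and 2 mark the start and the end of a match, and all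
   the letters of the rewriting system are greater. *)
Definition rule_tiles : seq (seq nat * seq nat) :=
  let rule k := nth ([::], [::]) rules k in
  [seq ([:: k.+2], sep_before (rule k).2) | k <- iota 0 (size rules)] ++
  [seq ([:: k.+2], sep_after (rule k).1) | k <- iota 0 (size rules)].

Definition other_tiles : seq (seq nat * seq nat) :=
  [:: ([:: 0], [:: 1; 0]); ([:: 1], [:: 0; 2]); ([:: 1], [:: halt; 0; 2])] ++
  rule_tiles.

Definition tiles : seq (seq nat * seq nat) :=
  ([:: 0], 1 :: sep_before u0) :: other_tiles.

(** Derivability in a Post normal system: a prefix is removed and a suffix appended. *)
Inductive post_steps : seq nat -> seq nat -> Prop :=
| post_refl u : post_steps u u
| post_step r v w : r \in rules -> post_steps (v ++ r.2) w ->
    post_steps (r.1 ++ v) w.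

Inductive tile_spec : seq nat * seq nat -> Prop :=
| tile_start_l : tile_spec ([:: 0], 1 :: sep_before u0)
| tile_start_r : tile_spec ([:: 0], [:: 1; 0])
| tile_end_l : tile_spec ([:: 1], [:: 0; 2])
| tile_end_r : tile_spec ([:: 1], [:: halt; 0; 2])
| tile_rule_l k r : r \in rules -> nth ([::], [::]) rules k = r ->
    tile_spec ([:: k.+2], sep_before r.2)
| tile_rule_r k r : r \in rules -> nth ([::], [::]) rules k = r ->
    tile_spec ([:: k.+2], sep_after r.1).

Lemma tilesP p : p \in tiles -> tile_spec p.
Proof.
rewrite !inE mem_cat; case/or4P=> [/eqP->|/eqP->|/eqP->|]; try by constructor.
case/orP=> [/eqP->|]; first by constructor.
by case/orP=> /mapP[k]; rewrite mem_iota => kR ->; constructor;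
  rewrite ?mem_nth.
Qed.

Lemma rule_tile r : r \in rules -> exists k,
  ([:: k], sep_before r.2) \in tiles /\ ([:: k], sep_after r.1) \in tiles.
Proof.
case/(nthP ([::], [::])) => k kR <-; exists k.+2.
have kI : k \in iota 0 (size rules) by rewrite mem_iota.
by split; rewrite !inE !mem_cat; apply/orP; right; apply/orP; right;
  apply/orP; right; apply/orP; right; apply/orP; [left|right];
  apply/mapP; exists k.
Qed.

Hypothesis rules_ok : forall r, r \in rules ->
  [/\ r.1 != [::], r.2 != [::], all (leq 3) r.1 & all (leq 3) r.2].
Hypothesis u0_ok : (u0 != [::]) && all (leq 3) u0.

(** Each rewriting step adds one tile with the same index to each side: the leading side [ps] writes
    the right-hand side of the rule, the lagging side [qs] consumes the left-hand side. The two end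
    tiles close the match when the pending word is the halting letter. *)
Lemma post_match u : post_steps u [:: halt] -> u != [::] ->
  exists ps qs, [/\ {subset ps <= tiles}, {subset qs <= tiles},
    unzip1 ps = unzip1 qs & pending u ++ flat ps = flat qs].
Proof.
move: {-1}[:: halt] (erefl [:: halt]) => w Ew uw.
elim: uw Ew => {u w} [u <- _ | r v w rR _ IHw /IHw{}IHw _].
  exists [:: ([:: 1], [:: 0; 2])], [:: ([:: 1], [:: halt; 0; 2])].
  by split=> // p; rewrite !inE => /eqP->; rewrite eqxx ?orbT //=.
have [r1 r2 _ _] := rules_ok rR.
have vr2 : v ++ r.2 != [::] by exact: cat_neq0r.
have [ps [qs [psT qsT eq1 eq2]]] := IHw vr2.
have [k [kl kr]] := rule_tile rR.
exists (([:: k], sep_before r.2) :: ps), (([:: k], sep_after r.1) :: qs);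
  split=> /=.
- by move=> p; rewrite inE => /predU1P[->|/psT].
- by move=> p; rewrite inE => /predU1P[->|/qsT].
- by rewrite eq1.
- have := cat_neq0l v r1; rewrite /flat /= -/(flat qs) -/(flat ps) -eq2 => r1v.
  by rewrite !catA -(pending_cat _ r1v) -(pending_cat_sep _ vr2) catA.
Qed.

(** [Inv] abstracts a set of words that contains all derivable ones. By [Inv_size] a left-hand side
    is matched within the current word and cannot reach into what the same step appends. *)
Variable Inv : seq nat -> Prop.
Hypothesis Inv0 : Inv u0.
Hypothesis Inv_step : forall r v,
  r \in rules -> Inv (r.1 ++ v) -> Inv (v ++ r.2).
Hypothesis Inv_size : forall u r, Inv u -> r \in rules -> size r.1 <= size u.
Hypothesis Inv_ok : forall u, Inv u -> (u != [::]) && all (leq 3) u.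

(* Two consecutive letters distinct from the separator 0 are never matched by
   the side that lags behind. *)
Lemma no_match u c x qs : u != [::] -> all (leq 3) u -> c != 0 ->
  {subset qs <= tiles} -> pending u ++ c :: x <> flat qs.
Proof.
move=> + + c0; elim: qs u => [|q qs IHqs] [|b u] //= _ /andP[b3 u3] qsT.
have [||||k r rR _|k r rR _] := tilesP (qsT q (mem_head _ _));
  rewrite /flat /= -/(flat qs).
1,2,3: by case=> Eb; rewrite Eb in b3.
- case=> Eb; case: u u3 => [_|b' u /= /andP[b'3 _]]; first by case=> Ec;
    rewrite Ec in c0.
  by case=> Eb'; rewrite Eb' in b'3.
- by have [_ + _ _] := rules_ok rR; case: (r.2) => // ? ? _ [] Eb;
    rewrite Eb in b3.
- move/esym/(sep_after_blocked (u := b :: u) isT c0) => [v [Eu v0 /esym]].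
  apply: IHqs => //; last by move=> q' q's; apply: qsT; rewrite inE q's orbT.
  by have : all (leq 3) (b :: u) := introT andP (conj b3 u3);
    rewrite Eu all_cat => /andP[].
Qed.

(** The letters of [u] force the next tile of the lagging side to consume a left-hand side, or to be
    the end tile when [u] is the halting letter. In the first case the leading tile has the same
    index: either it appends the right-hand side of the same rule, which is a rewriting step, or it
    writes the left-hand side again, which [no_match] excludes. *)
Lemma lag_match u ps qs : Inv u ->
  {subset ps <= tiles} -> {subset qs <= tiles} ->
  unzip1 ps = unzip1 qs -> pending u ++ flat ps = flat qs -> Inv [:: halt].
Proof.
elim: qs ps u => [|q qs IHqs] ps u Iu; have /andP[u_n0 u3] := Inv_ok Iu.
  by case: u u_n0 {Iu u3}.
case: ps => [|p ps] // psT qsT [Epq eq1].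
have psT' : {subset ps <= tiles} by move=> x xs; apply: psT;
  rewrite inE xs orbT.
have qsT' : {subset qs <= tiles} by move=> x xs; apply: qsT;
  rewrite inE xs orbT.
have tp := tilesP (psT p (mem_head _ _));
  have tq := tilesP (qsT q (mem_head _ _)).
move=> eq2; have : pending u ++ flat (p :: ps) = q.2 ++ flat qs by [].
case: tq qsT Epq eq2 => [|||| k r rR Er | k r rR Er] qsT Epq eq2.
1,2,3: by case: u u_n0 u3 {Iu eq2} => //= b u _ /andP[b3 _] [] Eb;
  rewrite Eb in b3.
- case: u u_n0 u3 Iu {eq2} => //= b u _ /andP[b3 u3] Iu [] Eb.
  case: u u3 Iu => [|b' u /= /andP[b'3 _] _]; first by rewrite Eb.
  by case=> Eb'; rewrite Eb' in b'3.
- have [_ + _ _] := rules_ok rR.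
  case: u u_n0 u3 {Iu eq2} => //= b u _ /andP[b3 _].
  by case: (r.2) => // ? ? _ [] Eb; rewrite Eb in b3.
have [r1 r2 r13 r23] := rules_ok rR.
case: tp Epq eq2 => [|||| k' r' r'R Er' | k' r' r'R Er'] //= [Ek] eq2.
all: have {Ek Er'} Er' : r' = r by rewrite -Er -Er' Ek.
- rewrite Er' /flat /= -/(flat ps) catA -pending_cat // => /esym.
  case/sep_after_pending => [|v Ev /esym Eqs].
    rewrite size_cat (leq_ltn_trans (Inv_size Iu rR)) // -addn1 leq_add2l.
    by case: (r.2) r2.
  pose v' := drop (size r.1) u.
  have Eu : u = r.1 ++ v'.
    rewrite -{1}(cat_take_drop (size r.1) u); congr cat.
    by rewrite -(takel_cat r.2 (Inv_size Iu rR)) Ev take_size_cat.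
  have Ev' : v = v' ++ r.2.
    by move: Ev; rewrite {1}Eu -catA => /eqP; rewrite eqseq_cat // eqxx => /eqP.
  apply: IHqs psT' qsT' eq1 Eqs.
  by rewrite Ev'; apply: Inv_step rR _; rewrite -Eu.
- rewrite Er' /flat /= -/(flat ps); move: (r1) (r13).
  case Er1: (r.1) => [//|c l] _ /= /andP[c3 _].
  move=> H; case: (@no_match u c (0 :: sep_after l ++ flat ps) (([:: k.+2],
    sep_after r.1) :: qs)) => //.
  + by rewrite -lt0n (leq_trans _ c3).
  + by rewrite /flat /= Er1; exact: H.
Qed.

(** First components are single letters, so both sequences have the same indices. After the common
    prefix is stripped, the first differing tiles can only be the two start tiles, and then
    [lag_match] applies. *)
Lemma tiles_code ps qs : {subset ps <= tiles} -> {subset qs <= tiles} ->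
  flatten (unzip1 ps) = flatten (unzip1 qs) -> flat ps = flat qs ->
  ps = qs \/ Inv [:: halt].
Proof.
elim: ps qs => [|p ps IHps] [|q qs] psT qsT; first by left.
- by have [] := tilesP (qsT q (mem_head _ _)).
- by have [] := tilesP (psT p (mem_head _ _)).
have psT' : {subset ps <= tiles} by move=> x xs; apply: psT;
  rewrite inE xs orbT.
have qsT' : {subset qs <= tiles} by move=> x xs; apply: qsT;
  rewrite inE xs orbT.
have unz rs ss : {subset rs <= tiles} -> {subset ss <= tiles} ->
    flatten (unzip1 rs) = flatten (unzip1 ss) -> unzip1 rs = unzip1 ss.
  elim: rs ss => [|r rs IHrs] [|s ss] // rsT ssT.
  + by have [] := tilesP (ssT s (mem_head _ _)).
  + by have [] := tilesP (rsT r (mem_head _ _)).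
  have rsT' : {subset rs <= tiles} by move=> x xs; apply: rsT;
    rewrite inE xs orbT.
  have ssT' : {subset ss <= tiles} by move=> x xs; apply: ssT;
    rewrite inE xs orbT.
  move=> E; have : r.1 = s.1 /\ flatten (unzip1 rs) = flatten (unzip1 ss).
    have sing t : t \in tiles -> exists a, t.1 = [:: a].
      by case/tilesP; eexists.
    have [a Ea] := sing r (rsT _ (mem_head _ _)).
    have [b Eb] := sing s (ssT _ (mem_head _ _)).
    by move: E; rewrite /= Ea Eb => -[-> ->].
  by case=> /= -> /(IHrs _ rsT' ssT') ->.
move=> eq1 eq2; case: (unz _ _ psT qsT eq1) => Epq {eq1}eq1.
have [Epq2 | pq2] := eqVneq p.2 q.2.
  have -> : p = q by case: (p) (q) Epq Epq2 => ? ? [? ?] /= -> ->.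
  case: (IHps qs psT' qsT') => [||->|]; [by rewrite eq1 | | by left | by right].
  by move: eq2; rewrite /flat /= Epq2 => /eqP;
    rewrite eqseq_cat // eqxx => /eqP.
right; have lag ps' qs' : {subset ps' <= tiles} -> {subset qs' <= tiles} ->
    unzip1 ps' = unzip1 qs' -> sep_before u0 ++ flat ps' = 0 :: flat qs' ->
      Inv [:: halt].
  have /andP[u0_n0 _] := u0_ok.
  by move=> ? ? ?; rewrite sep_before_pending // => -[]; apply: lag_match.
have tp := tilesP (psT p (mem_head _ _));
  have tq := tilesP (qsT q (mem_head _ _)).
have eq2' : p.2 ++ flat ps = q.2 ++ flat qs by [].
have rule_ends (r : seq nat * seq nat) x y : r \in rules ->
  sep_before r.2 ++ x <> sep_after r.1 ++ y.
  case/rules_ok; case: (r.1) (r.2) => [|a l] [|b m] //= _ _ /andP[a3 _] _ [] Ea.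
  by rewrite -Ea in a3.
(* The two end tiles clash in their second letters, 2 and 0; only pairs of start tiles and pairs of
   rule tiles remain. *)
case: tp tq Epq pq2 eq2' => [|||| k r rR Er | k r rR Er]
  [|||| k' r' r'R Er' | k' r' r'R Er'] //= Ek;
  try discriminate Ek; try by rewrite eqxx.
- by move=> _ [] /lag; apply.
- by move=> _ [] /esym/lag; apply.
- by case: Ek => Ek; rewrite -Er -Er' Ek eqxx.
- by case: Ek => Ek; rewrite -Er' -Ek Er => _ /(rule_ends r); case.
- by case: Ek => Ek; rewrite -Er' -Ek Er => _ /esym/(rule_ends r); case.
- by case: Ek => Ek; rewrite -Er -Er' Ek eqxx.
Qed.

End Tiles.

(** * Queue machines *)

Section Reachability.

Variables (C : Type) (step : C -> option C).

Inductive reach : C -> C -> Prop :=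
| reach_refl c : reach c c
| reach_step c d e : step c = Some d -> reach d e -> reach c e.

Lemma reach1 c d : step c = Some d -> reach c d.
Proof. by move=> cd; apply: reach_step cd (reach_refl d). Qed.

Lemma reach_trans c d e : reach c d -> reach d e -> reach c e.
Proof.
by elim=> // {}c d' {}d cd _ IHd /IHd; apply: reach_step.
Qed.

Lemma reach_final c d e : reach c d -> reach c e -> step d = None -> reach e d.
Proof.
move=> cd ce d_final;
  elim: ce d_final cd => // {c e} c c' e cc' _ IHe d_final cd.
apply: (IHe d_final);
  case: cd d_final cc' => [c0 -> // | c0 c1 d' -> c1d' _ [<-] //].
Qed.

Lemma reach_stuck c d : step c = None -> reach c d -> d = c.
Proof. by move=> + cd; case: cd => // {}c c1 {}d ->. Qed.

End Reachability.

Section QueueMachine.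

Variables (Q : eqType) (delta : Q -> nat -> option (seq nat * Q)).

Definition qstep (c : Q * seq nat) : option (Q * seq nat) :=
  if c.2 is x :: v then
    if delta c.1 x is Some (w, q) then Some (q, v ++ w) else None
  else None.

Lemma qstep_cons q x v w q' :
  delta q x = Some (w, q') -> qstep (q, x :: v) = Some (q', v ++ w).
Proof. by rewrite /qstep /= => ->. Qed.

Variables (al : seq nat) (base : nat) (Qs : seq Q) (qa : Q).
Hypothesis al_ok : forall x, x \in al -> 2 < x < base.
Hypothesis qa_in : qa \in Qs.
Hypothesis delta_qa : forall x, delta qa x = None.
Hypothesis delta_ok : forall q x w q', q \in Qs -> x \in al ->
  delta q x = Some (w, q') -> q' \in Qs /\ {subset w <= al}.

Definition state_letter (q : Q) : nat := base + index q Qs.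

Local Notation sc := state_letter.

(* The configuration (q, v) is the circular word made of the letter of q and of
   v read backwards, so that the letter to be read is on the left of q. *)
Definition trans_rules (q : Q) (x : nat) : seq (seq nat * seq nat) :=
  if delta q x is Some (w, q') then [:: ([:: x; sc q], sc q' :: rev w)]
  else if q == qa then [:: ([:: x; sc q], [:: sc q])] else [::].

(** The identity rules move a letter from the front to the end and thus rotate the circular word. *)
Definition queue_rules : seq (seq nat * seq nat) :=
  [seq ([:: x], [:: x]) | x <- al ++ map sc Qs] ++
  flatten [seq trans_rules q x | q <- Qs, x <- al].

Definition conf_word (c : Q * seq nat) : seq nat := rev c.2 ++ [:: sc c.1].

Lemma sc_inj : {in Qs &, injective sc}.
Proof. by move=> p q pQ qQ /addnI/index_inj; apply. Qed.

Lemma sc_al q x : x \in al -> (x == sc q) = false.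
Proof. by move=> /al_ok; rewrite /sc; lia. Qed.

Hypothesis base_ok : 2 < base.

Inductive rule_spec : seq nat * seq nat -> Prop :=
| rule_rot x : x \in al ++ map sc Qs -> rule_spec ([:: x], [:: x])
| rule_trans q x w q' : q \in Qs -> x \in al -> delta q x = Some (w, q') ->
    rule_spec ([:: x; sc q], sc q' :: rev w)
| rule_erase x : x \in al -> rule_spec ([:: x; sc qa], [:: sc qa]).

Lemma queue_rulesP r : reflect (rule_spec r) (r \in queue_rules).
Proof.
rewrite mem_cat; apply: (iffP orP).
  case=> [/mapP[x xal ->] | /flattenP[rs /allpairsP[[q x] /= [qQ xal ->]]]].
    exact: rule_rot.
  rewrite /trans_rules; case Ed: (delta q x) => [[w q']|].
    by rewrite inE => /eqP->; apply: rule_trans.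
  by case: eqP => // ->; rewrite inE => /eqP->; apply: rule_erase.
case=> {r} [x xal | q x w q' qQ xal Ed | x xal]; [left | right | right].
- by apply/mapP; exists x.
- apply/flattenP; exists (trans_rules q x); first exact: allpairs_f.
  by rewrite /trans_rules Ed inE.
- apply/flattenP; exists (trans_rules qa x); first exact: allpairs_f.
  by rewrite /trans_rules delta_qa eqxx inE.
Qed.

Lemma sc_ge3 q : 2 < sc q.
Proof. by rewrite /sc; lia. Qed.

Lemma al_ge3 (v : seq nat) : {subset v <= al} -> all (leq 3) v.
Proof. by move=> val; apply/allP => x /val/al_ok/andP[]. Qed.

Lemma queue_rules_ok r : r \in queue_rules ->
  [/\ r.1 != [::], r.2 != [::], all (leq 3) r.1 & all (leq 3) r.2].
Proof.
have al3 x : x \in al -> 2 < x by case/al_ok/andP.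
have sc3 := sc_ge3.
case/queue_rulesP => [x | q x w q' qQ xal /(delta_ok qQ xal)[_ wal] | x xal] /=.
- rewrite mem_cat andbT => xal; suff x3 : 2 < x by [].
  by case/orP: xal => [/al3 | /mapP[q _ ->]].
- by rewrite all_rev al_ge3 // al3 // !sc3.
- by rewrite al3 // !sc3.
Qed.

Lemma rotate_steps z t w : {subset z <= al ++ map sc Qs} ->
  post_steps queue_rules (t ++ z) w -> post_steps queue_rules (z ++ t) w.
Proof.
elim: z t => [|x z IHz] t zal; first by rewrite cats0.
rewrite -cat1s catA => tzw; apply: (@post_step _ ([:: x], [:: x])).
  by apply/queue_rulesP/rule_rot/zal/mem_head.
rewrite -catA; apply: IHz => [y yz|]; first by apply: zal; rewrite inE yz orbT.
exact: tzw.
Qed.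

Lemma sub_rot (v : seq nat) : {subset v <= al} ->
  {subset rev v <= al ++ map sc Qs}.
Proof. by move=> val x; rewrite mem_rev mem_cat => /val->. Qed.

Lemma accept_steps c d : reach qstep c d -> d.1 = qa ->
  c.1 \in Qs -> {subset c.2 <= al} ->
  post_steps queue_rules (conf_word c) [:: sc qa].
Proof.
elim=> {c d} [[q v] /= -> _ | c c' d cc' _ IHc Ed cQ cal].
  elim: v => [|x v IHv] val; first exact: post_refl.
  have val' : {subset v <= al} by move=> y yv; rewrite val ?inE ?yv ?orbT.
  rewrite /conf_word /= rev_cons -cats1 -!catA.
  apply: rotate_steps; first exact: sub_rot.
  apply: (@post_step _ ([:: x; sc qa], [:: sc qa])); last exact: IHv.
  by apply/queue_rulesP/rule_erase/val/mem_head.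
case: c cc' cQ cal => q [|x v] //; rewrite /qstep /=.
case Ed': (delta q x) => [[w q']|] // [Ec'] qQ xval.
have xal := xval _ (mem_head _ _); have [q'Q wal] := delta_ok qQ xal Ed'.
have val : {subset v <= al} by move=> y yv; rewrite xval ?inE ?yv ?orbT.
have := IHc Ed; rewrite -Ec' /= => /(_ q'Q) {}IHc.
rewrite /conf_word /= rev_cons -cats1 -!catA.
apply: rotate_steps; first exact: sub_rot.
apply: (@post_step _ ([:: x; sc q], sc q' :: rev w)).
  by apply/queue_rulesP/rule_trans.
have {}IHc : post_steps queue_rules (rev w ++ rev v ++ [:: sc q']) [:: sc qa].
  by rewrite catA -rev_cat; apply: IHc => y; rewrite mem_cat => /orP[/val|/wal].
(* The word is now [rev v ++ sc q' :: rev w], a rotation of the word of the next configuration. *)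
rewrite /= -[sc q' :: _]cat1s catA; apply: rotate_steps => //.
by move=> y; rewrite mem_cat inE => /orP[/(sub_rot val) // | /eqP->];
  rewrite mem_cat map_f ?orbT.
Qed.

Variable c0 : Q * seq nat.
Hypotheses (c0_Q : c0.1 \in Qs) (c0_al : {subset c0.2 <= al}).
Hypothesis reach_c0 : forall c, reach qstep c0 c -> c.1 != qa /\ c.2 != [::].

Lemma reach_ok c d : reach qstep c d -> c.1 \in Qs -> {subset c.2 <= al} ->
  d.1 \in Qs /\ {subset d.2 <= al}.
Proof.
elim=> {c d} // -[q [|x v]] c' d //; rewrite /qstep /=.
case Ed: (delta q x) => [[w q']|] // [<-] _ IHc qQ xval.
have [q'Q wal] := delta_ok qQ (xval x (mem_head _ _)) Ed.
apply: IHc => // y; rewrite mem_cat => /orP[yv|/wal //].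
by rewrite xval // inE yv orbT.
Qed.

(** The instance of [Inv] for a run that never accepts: all rotations of the words of reachable
    configurations. *)
Definition rotated (u : seq nat) : Prop :=
  exists c z1 z2, [/\ reach qstep c0 c,
    rev c.2 = z1 ++ z2 & u = z2 ++ sc c.1 :: z1].

Lemma rotated_c0 : rotated (conf_word c0).
Proof. by exists c0, [::], (rev c0.2); split=> //; apply: reach_refl. Qed.

Lemma rotated_ok u : rotated u -> (u != [::]) && all (leq 3) u.
Proof.
case=> -[q v] [z1 [z2 [/reach_ok[]//= qQ val Ev ->]]].
have := al_ge3 val; rewrite -all_rev Ev all_cat => /andP[z13 z23].
by rewrite all_cat /= z13 z23 sc_ge3 cat_neq0r.
Qed.

Lemma rotated_size u r : rotated u -> r \in queue_rules -> size r.1 <= size u.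
Proof.
case=> c [z1 [z2 [/reach_c0[_ c2] Ec ->]]] rR.
have : 0 < size (rev c.2) by rewrite size_rev lt0n size_eq0.
rewrite Ec !size_cat /= => zs.
by case/queue_rulesP: rR => * /=; lia.
Qed.

Lemma rotated_step r v : r \in queue_rules -> rotated (r.1 ++ v) ->
  rotated (v ++ r.2).
Proof.
move=> rR [c [z1 [z2 [c0c Ec Eu]]]].
have [cqa _] := reach_c0 c0c; have [cQ cal] := reach_ok c0c c0_Q c0_al.
have zal x : x \in z1 ++ z2 -> x \in al by rewrite -Ec mem_rev => /cal.
have z2al x : x \in z2 -> x \in al by move=> xz; rewrite zal // mem_cat xz orbT.
(* A rotation contains a single state letter, so a left-hand side [[:: x; sc q]] fits only when [z2]
   is the letter [x] alone, that is, when [x] is the letter to be read. *)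
have pair x q : x \in al -> q \in Qs -> [:: x;
  sc q] ++ v = z2 ++ sc c.1 :: z1 ->
    [/\ q = c.1, v = z1 & c.2 = x :: rev z1].
  move=> xal qQ; case: z2 z2al {zal} Ec {Eu} => [|y [|y' z2]] z2al Ec [].
  - by move=> Ex _; move: (sc_al c.1 xal); rewrite Ex eqxx.
  - move=> Exy /(sc_inj qQ cQ) Eq Ev; split=> //.
    by rewrite -[c.2]revK Ec rev_cat Exy.
  - move=> _ Ey _; have := z2al y'; rewrite !inE eqxx orbT => /(_ isT).
    by rewrite -Ey => /(sc_al q); rewrite eqxx.
case/queue_rulesP: rR Eu => [x | q x w q' qQ xal Ed | x xal].
- rewrite mem_cat => xal; case: z2 Ec {zal z2al pair} => [|y z2] Ec [-> Ev].
    by exists c, [::], z1; split=> //; [rewrite Ec cats0 | rewrite Ev].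
  exists c, (rcons z1 y), z2; split=> //; first by rewrite cat_rcons.
  by rewrite Ev -catA cats1.
- case/pair=> // Eq -> Ec2; exists (q', rev z1 ++ w), (rev w), z1; split=> //.
    apply: reach_trans c0c (reach1 _).
    by rewrite /qstep Ec2 -Eq Ed.
  by rewrite rev_cat revK.
- by case/pair=> // Eq; rewrite Eq eqxx in cqa.
Qed.

Lemma rotated_halt : ~ rotated [:: sc qa].
Proof.
case=> c [z1 [z2 [/reach_c0[_ c2] Ec /(congr1 size)]]].
have : 0 < size (rev c.2) by rewrite size_rev lt0n size_eq0.
by rewrite Ec !size_cat /=; lia.
Qed.
End QueueMachine.

(** * Register programs on a queue machine *)

Inductive reg := rE | rV | rS | rA | rX | rY | rT.

HB.instance Definition _ := gen_eqMixin reg.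

Record regs := Regs
  { reE : nat; reV : nat; reS : nat; reA : nat; reX : nat; reY : nat;
    reT : nat }.

Definition get (r : reg) (m : regs) : nat :=
  match r with
  | rE => reE m | rV => reV m | rS => reS m | rA => reA m
  | rX => reX m | rY => reY m | rT => reT m
  end.

Definition set_reg (r : reg) (n : nat) (m : regs) : regs :=
  let: Regs e v s a x y t := m in
  match r with
  | rE => Regs n v s a x y t | rV => Regs e n s a x y t
  | rS => Regs e v n a x y t | rA => Regs e v s n x y t
  | rX => Regs e v s a n y t | rY => Regs e v s a x n t
  | rT => Regs e v s a x y n
  end.

Definition incr (m : regs) (r : reg) : regs := set_reg r (get r m).+1 m.

Lemma get_set r r' n m :
  get r' (set_reg r n m) = if r' == r then n else get r' m.
Proof.
case: m => *; case: eqP => [-> | ]; first by case: r.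
by case: r; case: r' => //; case.
Qed.

Section Programs.

Variable L : eqType.

Inductive cmd :=
| Ins of seq reg
| Sq of cmd & cmd
| Loop of reg & cmd
| Case of reg & cmd & cmd
| Jmp of L
| Sw of reg & seq L
| Rd of seq L & L
| Acc.

HB.instance Definition _ := gen_eqMixin cmd.

Inductive op :=
| Stop
| OIns of seq reg & seq cmd
| ODec of reg & seq cmd & seq cmd
| ORead of seq (seq cmd) & seq cmd.

Variable block : L -> cmd.

(* A control state is the list of the commands that remain to be executed. *)
Definition opof (k : seq cmd) : op :=
  match k with
  | Ins w :: k' => OIns w k'
  | Sq c1 c2 :: k' => OIns [::] [:: c1, c2 & k']
  | Loop r c :: k' => ODec r [:: c, Loop r c & k'] k'
  | Case r c1 c2 :: k' => ODec r (c1 :: k') (c2 :: k')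
  | Jmp l :: _ => OIns [::] [:: block l]
  | Sw r (l :: ls) :: _ => ODec r [:: Sw r ls] [:: Jmp l]
  | Rd ls l :: _ => ORead [seq [:: Jmp l'] | l' <- ls] [:: Jmp l]
  | _ => Stop
  end.

Definition cconf := (seq cmd * (regs * seq nat))%type.

Definition cstep (c : cconf) : option cconf :=
  let: (k, (m, i)) := c in
  match opof k with
  | Stop => None
  | OIns w k' => Some (k', (foldl incr m w, i))
  | ODec r k1 k2 =>
      Some (if get r m is n.+1 then (k1, (set_reg r n m, i)) else (k2, (m, i)))
  | ORead ks k' =>
      Some (if i is s :: i' then (nth k' ks s, (m, i')) else (k', (m, i)))
  end.

Definition succs (o : op) : seq (seq cmd) :=
  match o with
  | Stop => [::]
  | OIns _ k => [:: k]
  | ODec _ k1 k2 => [:: k1; k2]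
  | ORead ks k => k :: ks
  end.

Fixpoint sw_states (r : reg) (ls : seq L) : seq (seq cmd) :=
  [:: Sw r ls] :: (if ls is _ :: ls' then sw_states r ls' else [::]).

Fixpoint states (c : cmd) (k : seq cmd) : seq (seq cmd) :=
  (c :: k) ::
  match c with
  | Sq c1 c2 => states c1 (c2 :: k) ++ states c2 k
  | Loop r c1 => states c1 (c :: k)
  | Case _ c1 c2 => states c1 k ++ states c2 k
  | Sw r ls => sw_states r ls
  | _ => [::]
  end.

Fixpoint labels (c : cmd) : seq L :=
  match c with
  | Sq c1 c2 | Case _ c1 c2 => labels c1 ++ labels c2
  | Loop _ c1 => labels c1
  | Jmp l => [:: l]
  | Sw _ ls => ls
  | Rd ls l => l :: ls
  | _ => [::]
  end.

Lemma mem_states c k : c :: k \in states c k.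
Proof. by case: c => *; rewrite inE eqxx. Qed.

(** A command list only ever runs into its subcommands with their continuations, into [k], or into a
    label; hence finitely many control states suffice. *)
Lemma states_closed (K : seq (seq cmd)) c k :
  {subset states c k <= K} -> k \in K ->
  (forall l, l \in labels c -> [:: Jmp l] \in K) ->
  (forall l, l \in labels c -> [:: block l] \in K) ->
  forall q, q \in states c k -> {subset succs (opof q) <= K}.
Proof.
elim: c k => [w|c1 IH1 c2 IH2|r c IHc|r c1 IH1 c2 IH2|l|r ls|ls l|]
  k sK kK lK bK q /=.
- by rewrite inE => /eqP-> q'; rewrite inE => /eqP->.
- have s1 : {subset states c1 (c2 :: k) <= K}.
    by move=> p ps; rewrite sK //= inE mem_cat ps orbT.
  have s2 : {subset states c2 k <= K}.
    by move=> p ps; rewrite sK //= inE mem_cat ps !orbT.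
  rewrite inE mem_cat => /or3P[/eqP->|qs|qs].
  + by move=> q'; rewrite inE => /eqP->; apply/s1/mem_states.
  + apply: (IH1 _ s1) qs; first exact/s2/mem_states.
    - by move=> l ls; rewrite lK //= mem_cat ls.
    - by move=> l ls; rewrite bK //= mem_cat ls.
  + by apply: (IH2 _ s2) qs => // l ls; rewrite ?lK ?bK //= mem_cat ls orbT.
- have s1 : {subset states c (Loop r c :: k) <= K}.
    by move=> p ps; rewrite sK //= inE ps orbT.
  have hK : Loop r c :: k \in K by apply: sK; rewrite /= inE eqxx.
  rewrite inE => /predU1P[->|qs]; last exact: (IHc _ s1) qs.
  by move=> q' /=; rewrite !inE => /orP[]/eqP-> //; apply/s1/mem_states.
- have s1 : {subset states c1 k <= K}.
    by move=> p ps; rewrite sK //= inE mem_cat ps orbT.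
  have s2 : {subset states c2 k <= K}.
    by move=> p ps; rewrite sK //= inE mem_cat ps !orbT.
  rewrite inE mem_cat => /or3P[/eqP->|qs|qs].
  + by move=> q'; rewrite !inE => /orP[]/eqP->; [apply: s1 | apply: s2];
      apply: mem_states.
  + by apply: (IH1 _ s1) qs => // l ls; rewrite ?lK ?bK //= mem_cat ls.
  + by apply: (IH2 _ s2) qs => // l ls; rewrite ?lK ?bK //= mem_cat ls orbT.
- by rewrite inE => /eqP-> q'; rewrite inE => /eqP->; apply: bK;
    rewrite inE eqxx.
- have : {subset sw_states r ls <= K}.
    by move=> p ps; rewrite sK //= inE ps orbT.
  rewrite inE => swK /predU1P[->|].
    case: ls lK swK {sK bK} => //= l ls lK swK q'; rewrite !inE => /orP[]/eqP->.
      by apply: swK; rewrite inE; case: (ls) => /= *; rewrite inE eqxx orbT.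
    by apply: lK; rewrite inE eqxx.
  elim: ls lK swK {sK bK} => [|l ls IHls] lK swK /=.
    by rewrite inE => /eqP->.
  rewrite inE => /predU1P[->|].
    move=> q' /=; rewrite !inE => /orP[]/eqP->.
      by apply: swK; rewrite inE; case: (ls) => /= *; rewrite inE eqxx orbT.
    by apply: lK; rewrite inE eqxx.
  apply: IHls => [l' ls' | p ps]; first by apply: lK; rewrite inE ls' orbT.
  by apply: swK; rewrite /= inE ps orbT.
- rewrite inE => /eqP-> q'; rewrite inE => /predU1P[->|/mapP[l' ls' ->]].
    by apply: lK; rewrite inE eqxx.
  by apply: lK; rewrite inE ls' orbT.
- by rewrite inE => /eqP->.
Qed.

(* 3 is a marker, 4 to 8 are the input symbols, 9 to 15 the registers; the
   letters from 16 on are left for the states. *)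
Definition letter_of_sym (s : nat) : nat := 4 + s.

Definition letter_of_reg (r : reg) : nat :=
  match r with
  | rE => 9 | rV => 10 | rS => 11 | rA => 12 | rX => 13 | rY => 14 | rT => 15
  end.

Local Notation hash := 3.

Definition alphabet : seq nat := iota 3 13.

(* The queue contains the marker [hash] once; read cyclically from there, the
   symbol letters spell the input, and the number of occurrences of a register
   letter is the content of this register.  The boolean tells whether the
   search for a letter has already met [hash]. *)
Definition delta (q : bool * seq cmd) (x : nat) :
    option (seq nat * (bool * seq cmd)) :=
  let: (ph, k) := q in
  match opof k with
  | Stop => None
  | OIns w k' => Some (x :: map letter_of_reg w, (false, k'))
  | ODec r k1 k2 =>
      Some (if ph then
              if x == hash then ([:: x], (false, k2))
              else if x == letter_of_reg r then ([::], (false, k1))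
              else ([:: x], q)
            else ([:: x], (x == hash, k)))
  | ORead ks k' =>
      Some (if ph then
              if x == hash then ([:: x], (false, k'))
              else if x < 9 then ([::], (false, nth k' ks (x - 4)))
              else ([:: x], q)
            else ([:: x], (x == hash, k)))
  end.

Definition is_sym (x : nat) := 3 < x < 9.

Definition represents (v : seq nat) (d : regs * seq nat) : Prop :=
  exists y1 y2, [/\ v = y2 ++ hash :: y1,
    {subset y1 ++ y2 <= behead alphabet},
    forall r, count_mem (letter_of_reg r) (y1 ++ y2) = get r d.1 &
    filter is_sym (y1 ++ y2) = map letter_of_sym d.2].

Local Notation qreach := (reach (qstep delta)).

Lemma has_split (T : Type) (p : pred T) (y : seq T) : has p y ->
  exists ya x yb, [/\ y = ya ++ x :: yb, p x & ~~ has p ya].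
Proof.
elim: y => //= z y IHy;
  have [pz _ | pz /= /IHy[ya [x [yb [-> px pya]]]]] := boolP (p z).
  by exists [::], z, y.
by exists (z :: ya), x, yb; split=> //=; rewrite negb_or pz.
Qed.

Lemma letter_of_reg_inj : injective letter_of_reg.
Proof. by case; case. Qed.

Lemma letter_of_reg_al r : letter_of_reg r \in behead alphabet.
Proof. by case: r. Qed.

Lemma letter_of_reg_sym r : is_sym (letter_of_reg r) = false.
Proof. by case: r. Qed.

Lemma scan q y z : (forall x, x \in y -> delta q x = Some ([:: x], q)) ->
  qreach (q, y ++ z) (q, z ++ y).
Proof.
elim: y z => [|x y IHy] z yq; first by rewrite cats0; apply: reach_refl.
apply: (@reach_step _ _ _ (q, (y ++ z) ++ [:: x])).
  by rewrite (qstep_cons _ (yq _ (mem_head _ _))).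
rewrite -catA -[z ++ x :: y]cat_rcons -cats1; apply: IHy => x' x'y.
by apply: yq; rewrite inE x'y orbT.
Qed.

Lemma seek k v d : represents v d ->
  (forall x, delta (false, k) x = Some ([:: x], (x == hash, k))) ->
  exists y, [/\ qreach ((false, k), v) ((true, k), rcons y hash),
    {subset y <= behead alphabet},
    forall r, count_mem (letter_of_reg r) y = get r d.1 &
    filter is_sym y = map letter_of_sym d.2].
Proof.
case=> y1 [y2 [-> yal yr yi]] kd; exists (y1 ++ y2); split=> //.
apply: (@reach_trans _ _ _ (false, k, (hash :: y1) ++ y2)).
  apply: scan => x xy; rewrite kd; have := yal x.
  by rewrite mem_cat xy orbT => /(_ isT); case: eqP => // ->.
by apply: reach1; rewrite (qstep_cons _ (kd _)) eqxx cats1.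
Qed.

(** Insertion happens at the current position. Decrementing and reading first rotate the queue past
    the marker and then make at most one turn: meeting the marker again means that the letter is
    absent, and the first symbol met is the next input symbol. *)
Lemma queue_step k m i k' d' v : cstep (k, (m, i)) = Some (k', d') ->
  represents v (m, i) -> exists2 v', represents v' d' &
  qreach ((false, k), v) ((false, k'), v').
Proof.
rewrite /cstep; case Ek: (opof k) => [|w q|r k1 k2|ks kn] //= [].
- move=> <- <- [y1 [y2 [-> yal yr yi]]].
  set w' := map letter_of_reg w.
  have ins x (z : seq nat) : qreach (false, k, x :: z) (false, q, z ++ x :: w').
    by apply: reach1; rewrite /qstep /= Ek.
  have w'al : {subset w' <= behead alphabet}.
    by move=> _ /mapP[r _ ->]; apply: letter_of_reg_al.
  have w'sym : filter is_sym w' = [::].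
    by rewrite /w'; elim: (w) => //= r w0; rewrite letter_of_reg_sym.
  have w'r r : get r (foldl incr m w) = get r m + count_mem (letter_of_reg r)
    w'.
    rewrite /w'; elim: (w) (m) => [|r' w0 IHw] m0 /=; first by rewrite addn0.
    rewrite IHw get_set addnA (inj_eq letter_of_reg_inj) eq_sym.
    by case: eqP => [-> | _]; rewrite ?addn1 ?addn0.
  (* If the marker itself is at the head, the inserted letters come right after it and so first in
     the reading order. *)
  case: y2 yal yr yi => [|x y2] yal yr yi; first last.
    exists ((y2 ++ hash :: y1) ++ x :: w'); last exact: ins.
    exists (y1 ++ x :: w'), y2; split.
    + by rewrite -catA.
    + move=> z; rewrite !mem_cat inE -!orbA => /or4P[zy|zx|/w'al //|zy];
        by apply: yal; rewrite mem_cat inE ?zy ?zx ?orbT.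
    + by move=> r; rewrite /= w'r -yr !count_cat /=; lia.
    + by rewrite /= -yi !filter_cat /= w'sym -catA; case: ifP.
  exists (y1 ++ hash :: w'); last exact: ins.
  exists w', y1; split=> // [z|r|].
  + by rewrite mem_cat => /orP[/w'al // | zy]; apply: yal; rewrite mem_cat zy.
  + by rewrite /= w'r -yr !count_cat /=; lia.
  + by rewrite /= -yi !filter_cat /= w'sym cats0.
- move=> Ekm /seek; case/(_ k) => [x|y [ky yal /= yr yi]];
    first by rewrite /= Ek.
  have scank ya yb : (letter_of_reg r \notin ya) ->
    {subset ya <= behead alphabet} ->
      qreach (true, k, ya ++ yb) (true, k, yb ++ ya).
    move=> rya yaal; apply: scan => x xya; rewrite /= Ek.
    have /negPf-> : x != letter_of_reg r by apply: contraNneq rya => <-.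
    by have := yaal _ xya; case: (x =P hash) => // ->.
  case Em: (get r m) Ekm => [|n] [<- <-].
    exists (rcons y hash).
      by exists [::], y; rewrite cats1.
    apply: reach_trans ky _; rewrite -cats1.
    apply: reach_trans (scank _ _ _ yal) _.
      by rewrite -has_pred1 has_count yr Em.
    by apply: reach1; rewrite /qstep /= Ek cats1.
  have : has (pred1 (letter_of_reg r)) y by rewrite has_count yr Em.
  case/has_split=> ya [x [yb [Ey /eqP Ex rya]]].
  rewrite {}Ey {}Ex in ky yal yr yi *.
  exists (yb ++ hash :: ya).
    exists ya, yb; split=> // [z|r'|].
    + by rewrite mem_cat => zy; apply: yal; rewrite mem_cat inE orbCA zy orbT.
    + have := yr r'; rewrite get_set !count_cat /= (inj_eq letter_of_reg_inj).
      by rewrite [r == r']eq_sym; case: eqP => [-> | _] /=; rewrite ?Em; lia.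
    + by rewrite -yi !filter_cat /= letter_of_reg_sym.
  apply: reach_trans ky _; rewrite rcons_cat /= -cats1.
  apply: reach_trans (scank _ _ _ _) _; first by rewrite -has_pred1.
    by move=> z zy; apply: yal; rewrite mem_cat zy.
  apply: reach1; rewrite /= -catA (@qstep_cons _ _ _ _ _ [::] (false,
    k1)) ?cats0 //=.
  by rewrite Ek eqxx; case: (r).
- move=> Ekm /seek; case/(_ k) => [x|y [ky yal /= yr yi]];
    first by rewrite /= Ek.
  have scank ya yb : ~~ has is_sym ya -> {subset ya <= behead alphabet} ->
      qreach (true, k, ya ++ yb) (true, k, yb ++ ya).
    move=> /hasPn sya yaal; apply: scan => x xya; rewrite /= Ek.
    have := sya x xya; have := yaal _ xya.
    rewrite -[behead alphabet]/(iota 4 12) mem_iota /is_sym.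
    move=> /andP[x4 _]; rewrite x4 /= -leqNgt => x9; rewrite ltnNge x9 /=.
    by case: eqP => // Ex; rewrite Ex in x4.
  case: i yi Ekm => [|s i] yi [<- <-].
    exists (rcons y hash).
      by exists [::], y; rewrite cats1.
    apply: reach_trans ky _; rewrite -cats1.
    apply: reach_trans (scank _ _ _ yal) _.
      by rewrite has_filter yi.
    by apply: reach1; rewrite /qstep /= Ek cats1.
  have : has is_sym y by rewrite has_filter yi.
  case/has_split=> ya [x [yb [Ey xs sya]]]; rewrite {}Ey in ky yal yr yi *.
  have [Ex yi'] : x = letter_of_sym s /\ filter is_sym (ya ++
    yb) = map letter_of_sym i.
    move: yi; rewrite !filter_cat /= xs.
    have -> : filter is_sym ya = [::] by apply/eqP;
      rewrite -[_ == _]negbK -has_filter.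
    by case.
  exists (yb ++ hash :: ya).
    exists ya, yb; split=> // [z|r'].
    + by rewrite mem_cat => zy; apply: yal; rewrite mem_cat inE orbCA zy orbT.
    + rewrite -yr !count_cat /=; case: eqP => // Er.
      by move: xs; rewrite Er letter_of_reg_sym.
  apply: reach_trans ky _; rewrite rcons_cat /= -cats1.
  apply: reach_trans (scank _ _ sya _) _.
    by move=> z zy; apply: yal; rewrite mem_cat zy.
  apply: reach1; rewrite /= -catA.
  rewrite (@qstep_cons _ _ _ _ _ [::] (false, nth kn ks s)) ?cats0 //=.
  move: xs; rewrite Ek /is_sym Ex /letter_of_sym addKn => /andP[_ ->].
  by case: eqP => //; lia.
Qed.

Lemma queue_run c d v : reach cstep c d -> represents v c.2 ->
  exists2 v', represents v' d.2 & qreach ((false, c.1), v) ((false, d.1), v').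
Proof.
move=> cd; elim: cd v => {c d} [c v cv | [k [m i]] [k' d'] d kk' _ IHd v cv].
  by exists v => //; apply: reach_refl.
have [v1 v1d' kv1] := queue_step kk' cv.
have [v' v'd k'v'] := IHd _ v1d'.
by exists v' => //; apply: reach_trans kv1 k'v'.
Qed.

Section Closed.

Variable Ks : seq (seq cmd).
Hypothesis Ks_closed : forall k, k \in Ks -> {subset succs (opof k) <= Ks}.

Definition queue_states : seq (bool * seq cmd) :=
  [seq (b, k) | b <- [:: false; true], k <- Ks].

Lemma mem_queue_states b k : ((b, k) \in queue_states) = (k \in Ks).
Proof.
rewrite !mem_cat in_nil orbF; apply/orP/idP => [[]/mapP[k' k'K [_ ->]] // | kK].
by case: b; [right | left]; apply/mapP; exists k.
Qed.

Lemma delta_closed q x w q' : q \in queue_states -> x \in alphabet ->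
  delta q x = Some (w, q') -> q' \in queue_states /\ {subset w <= alphabet}.
Proof.
case: q q' => b k [b' k']; rewrite !mem_queue_states => k_in xal;
  have kK := Ks_closed k_in.
have x1 : {subset [:: x] <= alphabet} by move=> y; rewrite inE => /eqP->.
have n1 : {subset [::] <= alphabet} by [].
rewrite /delta; case: (opof k) (kK) => [|u q|r k1 k2|ks kn] //= sK E.
- case: E => <- _ <-; split; first by rewrite sK ?inE ?eqxx.
  by move=> y; rewrite inE => /predU1P[-> // | /mapP[r _ ->]]; case: r.
- have [s1 s2] : k1 \in Ks /\ k2 \in Ks by split; apply: sK;
    rewrite !inE eqxx ?orbT.
  by move: E; do ![case: ifP => _] => -[<- _ <-]; split.
- have [s1 s2] : kn \in Ks /\ nth kn ks (x - 4) \in Ks.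
    split; apply: sK; rewrite inE ?eqxx //;
      have [/mem_nth-> | /(nth_default kn)->] :=
      ltnP (x - 4) (size ks); by rewrite ?eqxx ?orbT.
  by move: E; do ![case: ifP => _] => -[<- _ <-]; split.
Qed.

End Closed.

End Programs.

(** * Evaluating lambda-terms with a register program *)

Fixpoint triangle (n : nat) : nat := if n is m.+1 then n + triangle m else 0.

Definition pcode (x y : nat) : nat := y + triangle (x + y).

(** The successor in Cantor's enumeration along the diagonals; unpairing a number means iterating it
    that many times from [(0, 0)]. *)
Definition next_pair (p : nat * nat) : nat * nat :=
  if p.1 is x.+1 then (x, p.2.+1) else (p.2.+1, 0).

Lemma iter_next_pair x y : iter (pcode x y) next_pair (0, 0) = (x, y).
Proof.
have diag : forall n m, iter m next_pair (n + m, 0) = (n, m).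
  move=> n m; elim: m n => [|m IHm] n; first by rewrite addn0.
  by rewrite iterS addnS -addSn IHm.
have base : forall n, iter (triangle n) next_pair (0, 0) = (n, 0).
  by elim=> // n IHn; rewrite /= iterD IHn (diag 0 n).
by rewrite /pcode iterD base diag.
Qed.

Section Macros.

Variables (L : eqType) (block : L -> cmd L).

Local Notation creach := (reach (cstep block)).

Definition runs (c : cmd L) (m m' : regs) : Prop :=
  forall k i, creach (c :: k, (m, i)) (k, (m', i)).

Definition seqc (cs : seq (cmd L)) (c : cmd L) : cmd L := foldr (@Sq L) c cs.

Lemma runs_ins w m : runs (Ins L w) m (foldl incr m w).
Proof. by move=> k i; apply: reach1. Qed.

Lemma runs_sq c1 c2 m1 m2 m3 :
  runs c1 m1 m2 -> runs c2 m2 m3 -> runs (Sq c1 c2) m1 m3.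
Proof.
move=> r1 r2 k i; apply: (reach_step (d := ([:: c1, c2 & k], (m1, i)))) => //.
exact: reach_trans (r1 _ _) (r2 _ _).
Qed.

Lemma runs_loop0 r c m : get r m = 0 -> runs (Loop r c) m m.
Proof. by move=> m0 k i; apply: reach1; rewrite /= m0. Qed.

Lemma runs_loopS r c n m m1 m2 : get r m = n.+1 -> runs c (set_reg r n m) m1 ->
  runs (Loop r c) m1 m2 -> runs (Loop r c) m m2.
Proof.
move=> mS rc rl k i.
apply: (reach_step (d := ([:: c, Loop r c & k], (set_reg r n m, i)))).
  by rewrite /= mS.
exact: reach_trans (rc _ _) (rl _ _).
Qed.

Lemma runs_case0 r c1 c2 m m' : get r m = 0 -> runs c2 m m' ->
  runs (Case r c1 c2) m m'.
Proof.
move=> m0 rc k i; apply: (reach_step (d := (c2 :: k, (m, i)))) (rc _ _).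
by rewrite /= m0.
Qed.

Lemma runs_caseS r c1 c2 n m m' : get r m = n.+1 ->
  runs c1 (set_reg r n m) m' ->
  runs (Case r c1 c2) m m'.
Proof.
move=> m0 rc k i; apply: (reach_step (d := (c1 :: k, (set_reg r n m,
  i)))) (rc _ _).
by rewrite /= m0.
Qed.

Definition clear_cmd (r : reg) : cmd L := Loop r (Ins L [::]).

Lemma runs_clear r m : runs (clear_cmd r) m (set_reg r 0 m).
Proof.
move En: (get r m) => n; elim: n m En => [|n IHn] m En.
  have -> : set_reg r 0 m = m by move: En; case: m; case: r => /= *; congruence.
  exact: runs_loop0.
apply: (runs_loopS En (runs_ins _ _)).
have -> : set_reg r 0 m = set_reg r 0 (set_reg r n m) by case: m {En};
  case: (r).
by apply: IHn; rewrite get_set eqxx.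
Qed.

Definition move_cmd (r1 r2 : reg) : cmd L := Loop r1 (Ins L [:: r2]).

Lemma runs_move r1 r2 m : r1 <> r2 ->
  runs (move_cmd r1 r2) m (set_reg r2 (get r2 m + get r1 m) (set_reg r1 0 m)).
Proof.
move=> r12; move En: (get r1 m) => n; elim: n m En => [|n IHn] m En.
  have -> : set_reg r2 (get r2 m + 0) (set_reg r1 0 m) = m.
    by move: En; case: m; case: r1 r12; case: r2 => //= *; rewrite addn0;
      congruence.
  exact: runs_loop0.
apply: (runs_loopS En (runs_ins _ _)); rewrite /=.
set m1 := incr _ r2.
have -> : set_reg r2 (get r2 m + n.+1) (set_reg r1 0 m) =
    set_reg r2 (get r2 m1 + n) (set_reg r1 0 m1).
  by rewrite /m1 /incr; case: (m); case: (r1) r12; case: (r2) => //= *;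
    congr Regs; lia.
apply: IHn; rewrite /m1 /incr !get_set eqxx; case: eqP => // r21.
Qed.

(** The first loop leaves [x + y] in [rX] and [y] in [rT]. Each round of the second one turns [n.+1]
    in [rX] into [n] and adds [n.+1] to [rT], which sums up to the triangular number. *)
Definition pair_cmd : cmd L :=
  Sq (Loop rY (Ins L [:: rX; rT]))
     (Loop rX (seqc [:: move_cmd rX rY; Ins L [:: rT]] (Loop rY (Ins L [:: rX;
       rT])))).

Lemma runs_pair e v s a x y :
  runs pair_cmd (Regs e v s a x y 0) (Regs e v s a 0 0 (pcode x y)).
Proof.
have rY_loop n x' t : runs (Loop rY (Ins L [:: rX; rT])) (Regs e v s a x' n t)
    (Regs e v s a (x' + n) 0 (t + n)).
  elim: n x' t => [|n IHn] x' t; first by rewrite !addn0; apply: runs_loop0.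
  rewrite !addnS -!addSn; apply: runs_loopS (IHn _ _); first by [].
  exact: runs_ins.
apply: runs_sq (rY_loop _ _ _) _; rewrite add0n.
rewrite /pcode.
move: (x + y) => n; elim: n y => [|n IHn] t; first by rewrite /= addn0;
  apply: runs_loop0.
apply: runs_loopS; first by [].
  apply: runs_sq; first exact: runs_move.
  apply: runs_sq (runs_ins _ _) _.
  exact: rY_loop.
rewrite /= add0n; have ->
  : t + (n.+1 + triangle n) = t.+1 + n + triangle n by lia.
exact: IHn.
Qed.

Definition unpair_cmd : cmd L :=
  Loop rT (Case rX (Ins L [:: rY]) (Sq (move_cmd rY rX) (Ins L [:: rX]))).

Lemma runs_unpair e v s a x y :
  runs unpair_cmd (Regs e v s a 0 0 (pcode x y)) (Regs e v s a x y 0).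
Proof.
have unpair n p : runs unpair_cmd (Regs e v s a p.1 p.2 n)
    (let q := iter n next_pair p in Regs e v s a q.1 q.2 0).
  elim: n p => [|n IHn] p; first exact: runs_loop0.
  rewrite iterSr; apply: runs_loopS (IHn _); first by [].
  case: p => -[|x'] y' /=.
    apply: runs_case0; first by [].
    apply: runs_sq; first exact: runs_move.
    exact: runs_ins.
  by apply: runs_caseS; [reflexivity | apply: runs_ins].
by have := unpair (pcode x y) (0, 0); rewrite iter_next_pair.
Qed.

Lemma reach_sq c c' m m' i d : runs c m m' ->
  creach ([:: c'], (m', i)) d -> creach ([:: Sq c c'], (m, i)) d.
Proof.
move=> rc; apply: reach_trans.
apply: (reach_step (d := ([:: c; c'], (m, i)))) => //; exact: rc.
Qed.

Lemma reach_sw_nth r ls l m i : get r m < size ls ->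
  creach ([:: Sw r ls], (m, i))
         ([:: Jmp (nth l ls (get r m))], (set_reg r 0 m, i)).
Proof.
move En: (get r m) => n; elim: n ls m En => [|n IHn] [|l' ls] // m Em /= nls.
  have -> : set_reg r 0 m = m by move: Em; case: m; case: (r) => /= *;
    congruence.
  by apply: reach1; rewrite /= Em.
apply: (reach_step (d := ([:: Sw r ls], (set_reg r n m, i)))).
  by rewrite /= Em.
have -> : set_reg r 0 m = set_reg r 0 (set_reg r n m).
  by case: m {Em}; case: (r).
by apply: IHn; rewrite // get_set eqxx.
Qed.

Lemma reach_sw r ls l m i : l \in ls -> get r m = index l ls ->
  creach ([:: Sw r ls], (m, i)) ([:: Jmp l], (set_reg r 0 m, i)).
Proof.
move=> lls Em; have := @reach_sw_nth r ls l m i.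
by rewrite Em nth_index // index_mem; apply.
Qed.

Lemma reach_jmp l k m i d : creach ([:: block l], (m, i)) d ->
  creach (Jmp l :: k, (m, i)) d.
Proof. by apply: reach_step. Qed.


End Macros.

(** * An abstract machine with closures, environment and stack *)

Inductive lab :=
| Ev of term | Arg of term | Call | Ret
| Init | Main | OnSym of nat | OnEnd | Decide | Yes | No.

HB.instance Definition _ := gen_eqMixin lab.
HB.instance Definition _ := gen_eqMixin term.

Section Machine.

Variables (Tm : seq term) (init fin : term) (on_sym : nat -> term) (yes : term).
Variable nsym : nat.

Definition returns : seq lab := [:: Call; Main; Decide] ++ map Arg Tm.

Definition ret_index (l : lab) : nat := index l returns.

Arguments ret_index : simpl never.

Definition push (r : reg) : seq (cmd lab) :=
  [:: move_cmd _ r rX; move_cmd _ rS rY; pair_cmd _; move_cmd _ rT rS].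

Definition push_label (l : lab) : seq (cmd lab) :=
  Ins _ (nseq (ret_index l) rX) :: behead (push rX).

Definition pop (r : reg) : seq (cmd lab) :=
  [:: move_cmd _ rS rT; unpair_cmd _; move_cmd _ rX r; move_cmd _ rY rS].

Definition load_arg : seq (cmd lab) :=
  [:: clear_cmd _ rE; move_cmd _ rV rX; pair_cmd _; move_cmd _ rT rE].

(* E is the environment, V the value just computed, S the stack. *)
Definition block (l : lab) : cmd lab :=
  match l with
  | Ev (var 0) =>
      seqc [:: move_cmd _ rE rT; unpair_cmd _; clear_cmd _ rV;
               move_cmd _ rX rV; clear_cmd _ rY] (Jmp Ret)
  | Ev (var i.+1) =>
      seqc [:: move_cmd _ rE rT; unpair_cmd _; clear_cmd _ rX; move_cmd _ rY rE]
        (Jmp (Ev (var i)))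
  | Ev (lam s) =>
      seqc [:: Ins _ (nseq (index s Tm) rX); move_cmd _ rE rY; pair_cmd _;
               clear_cmd _ rV; move_cmd _ rT rV] (Jmp Ret)
  | Ev (app s t) =>
      seqc ([:: Loop rE (Ins _ [:: rX; rA]); move_cmd _ rA rE] ++
            behead (push rX) ++ push_label (Arg t)) (Jmp (Ev s))
  | Arg t =>
      seqc (clear_cmd _ rE :: pop rE ++ push rV ++ push_label Call) (Jmp (Ev t))
  | Call =>
      seqc [:: move_cmd _ rS rT; unpair_cmd _; move_cmd _ rY rS;
               move_cmd _ rX rT; unpair_cmd _; move_cmd _ rX rA;
               clear_cmd _ rE; move_cmd _ rV rX; pair_cmd _; move_cmd _ rT rE]
        (Sw rA (map Ev Tm))
  | Ret => seqc (pop rA) (Sw rA returns)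
  | Init => seqc (push_label Main) (Jmp (Ev init))
  | Main => Rd (map OnSym (iota 0 nsym)) OnEnd
  | OnSym i => seqc (load_arg ++ push_label Main) (Jmp (Ev (on_sym i)))
  | OnEnd => seqc (load_arg ++ push_label Decide) (Jmp (Ev fin))
  | Decide =>
      seqc [:: move_cmd _ rV rT; unpair_cmd _; move_cmd _ rX rA]
        (Sw rA [seq if s == yes then Yes else No | s <- Tm])
  | Yes => Acc _
  | No => Sw rA [::]
  end.

(** The term stored in a closure is the body of the abstraction. Its code is its position in the
    finite list [Tm], which contains every term that the machine meets. *)
Inductive val := Clo of term & seq val.

Fixpoint num (v : val) : nat :=
  let: Clo s env := v in
  pcode (index s Tm) (foldr (fun u n => pcode (num u) n) 0 env).

Definition num_env (env : seq val) : nat :=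
  foldr (fun u n => pcode (num u) n) 0 env.

Fixpoint msubst (k : nat) (us : seq term) (s : term) : term :=
  match s with
  | var i => if i < k then var i else nth (var i) us (i - k)
  | app s1 s2 => app (msubst k us s1) (msubst k us s2)
  | lam s1 => lam (msubst k.+1 us s1)
  end.

Fixpoint term_of (v : val) : term :=
  let: Clo s env := v in lam (msubst 1 (map term_of env) s).

HB.instance Definition _ := gen_eqMixin val.

Inductive wf_val : val -> Prop :=
| wf_clo s env : s \in Tm -> closed_at (size env).+1 s ->
    (forall u, u \in env -> wf_val u) -> wf_val (Clo s env).

Lemma closed_at_le k k' s : k <= k' -> closed_at k s -> closed_at k' s.
Proof.
elim: s k k' => [j|s1 IH1 s2 IH2|s IHs] k k' kk' /=.
- by move/leq_trans; apply.
- by move=> /andP[/(IH1 _ _ kk')-> /(IH2 _ _ kk')->].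
- exact: IHs.
Qed.

Lemma subst_closed u k s : closed_at k s -> subst u k s = s.
Proof.
elim: s k => [j|s1 IH1 s2 IH2|s IHs] k /=.
- by case: eqP => // ->; rewrite ltnn.
- by move=> /andP[/IH1-> /IH2->].
- by move/IHs->.
Qed.

Lemma msubst_closed k us s : closed_at (k + size us) s ->
  (forall u, u \in us -> closed_at 0 u) -> closed_at k (msubst k us s).
Proof.
move=> + us_closed; elim: s k => [j|s1 IH1 s2 IH2|s IHs] k /=.
- case: (ltnP j k) => //= kj jk; apply: closed_at_le (leq0n k) _.
  by apply/us_closed/mem_nth; rewrite ltn_subLR.
- by move=> /andP[/IH1-> /IH2->].
- by rewrite -addSn; apply: IHs.
Qed.

Lemma subst_msubst k v us s : (forall u, u \in us -> closed_at 0 u) ->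
  subst v k (msubst k.+1 us s) = msubst k (v :: us) s.
Proof.
move=> us_closed; elim: s k => [j|s1 IH1 s2 IH2|s IHs] k /=.
- rewrite ltnS leq_eqVlt; case: (ltngtP j k) => [jk|kj|->] /=.
  + by rewrite ltn_eqF.
  + rewrite -[j - k]prednK ?subn_gt0 //= -subnS.
    have [js|js] := ltnP (j - k.+1) (size us).
      by rewrite subst_closed //;
        apply/(closed_at_le (leq0n k))/us_closed/mem_nth.
    by rewrite nth_default //= gtn_eqF.
  + by rewrite eqxx subnn.
- by rewrite IH1 IH2.
- by rewrite IHs.
Qed.

Lemma wf_closed v : wf_val v -> closed_at 0 (term_of v).
Proof.
elim=> s env _ s_closed _ IHenv; rewrite /=.
apply: msubst_closed; first by rewrite size_map add1n.
by move=> _ /mapP[u /IHenv u_closed ->].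
Qed.

Lemma term_of_closed env : (forall u, u \in env -> wf_val u) ->
  forall u, u \in map term_of env -> closed_at 0 u.
Proof. by move=> env_wf _ /mapP[u /env_wf/wf_closed u_closed ->]. Qed.

Hypothesis Tm_app : forall s t, app s t \in Tm -> s \in Tm /\ t \in Tm.
Hypothesis Tm_lam : forall s, lam s \in Tm -> s \in Tm.
Hypothesis Tm_var : forall j, var j.+1 \in Tm -> var j \in Tm.

Local Notation creach := (reach (cstep block)).

Ltac run_cmd := apply: reach_sq;
  [first [ exact: runs_move | exact: runs_ins | exact: runs_clear
         | exact: runs_pair | exact: runs_unpair ] |]; rewrite /= ?add0n ?addn0.

Lemma foldl_incr_nseq n e v s a x y t :
  foldl incr (Regs e v s a x y t) (nseq n rX) = Regs e v s a (n + x) y t.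
Proof. by elim: n x => //= n IHn x; rewrite IHn addSnnS. Qed.

Lemma runs_copy e v s : runs block (Loop rE (Ins _ [:: rX; rA]))
  (Regs e v s 0 0 0 0) (Regs 0 v s e e 0 0).
Proof.
have loop n a x : runs block (Loop rE (Ins _ [:: rX; rA]))
    (Regs n v s a x 0 0) (Regs 0 v s (a + n) (x + n) 0 0).
  elim: n a x => [|n IHn] a x; first by rewrite !addn0; apply: runs_loop0.
  rewrite !addnS -!addSn; apply: runs_loopS (IHn _ _); first by [].
  exact: runs_ins.
exact: loop.
Qed.

Lemma run_ret e v l s i : l \in returns ->
  creach ([:: Jmp Ret], (Regs e v (pcode (ret_index l) s) 0 0 0 0, i))
         ([:: Jmp l], (Regs e v s 0 0 0 0, i)).
Proof.
move=> lr; apply: reach_jmp; move En: (ret_index l) => n.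
do 4!run_cmd.
exact: (@reach_sw _ _ rA _ _ (Regs e v s n 0 0 0)).
Qed.

(** Induction on the evaluation. The calling convention: the label to return to is on top of the
    stack, the result ends up in [rV], the rest [s0] of the stack is restored, and [rE] may hold
    anything. *)
Lemma simulate t w : eval t w -> forall s env l v0 s0 i,
  s \in Tm -> closed_at (size env) s -> (forall u, u \in env -> wf_val u) ->
  l \in returns -> t = msubst 0 (map term_of env) s ->
  exists v e, [/\ term_of v = w, wf_val v &
  creach ([:: Jmp (Ev s)],
           (Regs (num_env env) v0 (pcode (ret_index l) s0) 0 0 0 0, i))
         ([:: Jmp l], (Regs e (num v) s0 0 0 0 0, i))].
Proof.
have lookup j env l v0 s0 i : j < size env -> l \in returns ->
  creach ([:: Jmp (Ev (var j))],
           (Regs (num_env env) v0 (pcode (ret_index l) s0) 0 0 0 0, i))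
         ([:: Jmp l], (Regs 0 (num (nth (Clo (var 0) [::]) env j)) s0 0 0 0 0,
           i)).
  elim: j env => [|j IHj] [|u env] // js lr; apply: reach_jmp;
    move En: (ret_index l) => n; rewrite /=.
    do 5!run_cmd.
    by rewrite -En; apply: run_ret.
  do 4!run_cmd.
  by rewrite -En; apply: IHj.
have var_term j env : j < size env -> term_of (nth (Clo (var 0) [::]) env j) =
    nth (var j) (map term_of env) (j - 0).
  by move=> js; rewrite subn0 (nth_map (Clo (var 0) [::])).
elim=> {t w} [s0 | t1 t2 s' v2 w _ IH1 _ IH2 _ IH3] [j|s1 s2|s1] env l v0 s0' i
  sT s_closed env_wf lr // Et; rewrite /= in Et.
- rewrite -var_term // in Et.
  exists (nth (Clo (var 0) [::]) env j), 0; split=> //;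
    first exact/env_wf/mem_nth.
  exact: lookup.
- exists (Clo s1 env), 0; split=> //.
    by constructor=> //; apply: Tm_lam.
  apply: reach_jmp; move En: (ret_index l) => n /=.
  rewrite -/(num_env env).
  apply: reach_sq; first exact: runs_ins.
  rewrite foldl_incr_nseq; do 4!run_cmd.
  by rewrite -En; apply: run_ret.
- by rewrite -var_term // in Et; case: (nth _ _ _) Et.
case: Et => Et1 Et2; have [s1T s2T] := Tm_app sT.
have /andP[s1_closed s2_closed] := s_closed.
have ret_arg : Arg s2 \in returns by rewrite /returns mem_cat map_f ?orbT.
have ret_call : Call \in returns by rewrite inE eqxx.
set n := ret_index l; set E := num_env env.
have [f [e1 [Ef f_wf run_f]]] := IH1 s1 env (Arg s2) v0
  (pcode E (pcode n s0')) i s1T s1_closed env_wf ret_arg Et1.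
case: f Ef f_wf run_f => b env' [Es'] f_wf run_f.
set nf := num (Clo b env') in run_f.
have [u [e2 [Eu u_wf run_u]]] := IH2 s2 env Call 0
  (pcode nf (pcode n s0')) i s2T s2_closed env_wf ret_call Et2.
move: (f_wf); case E' : _ / => [b' env'' bT b_closed env'_wf];
  case: E' => Eb Eenv.
subst b' env''.
have uenv_wf u' : u' \in u :: env' -> wf_val u'.
  by rewrite inE => /predU1P[-> | /env'_wf].
have [|v [e3 [Ev' v_wf run_v]]] := IH3 b (u :: env') l 0 s0' i bT b_closed
  uenv_wf lr.
  (* Substituting the argument into the body amounts to extending the environment, because the
     values in the environment are closed. *)
  by rewrite -Es' -Eu subst_msubst //; apply: term_of_closed.
exists v, e3; split=> //.
have run1 : creach ([:: Jmp (Ev (app s1 s2))],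
    (Regs E v0 (pcode n s0') 0 0 0 0, i))
  ([:: Jmp (Ev s1)],
    (Regs E v0 (pcode (ret_index (Arg s2)) (pcode E (pcode n s0'))) 0 0 0 0,
      i)).
  apply: reach_jmp; rewrite /=.
  apply: reach_sq; first exact: runs_copy.
  do 4!run_cmd.
  apply: reach_sq; first exact: runs_ins.
  by rewrite foldl_incr_nseq; do 3!run_cmd; apply: reach_refl.
have run2 : creach ([:: Jmp (Arg s2)],
    (Regs e1 nf (pcode E (pcode n s0')) 0 0 0 0, i))
  ([:: Jmp (Ev s2)],
    (Regs E 0 (pcode (ret_index Call) (pcode nf (pcode n s0'))) 0 0 0 0, i)).
  apply: reach_jmp; rewrite /=.
  do 9!run_cmd.
  apply: reach_sq; first exact: runs_ins.
  by rewrite foldl_incr_nseq; do 3!run_cmd; apply: reach_refl.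
have run3 : creach ([:: Jmp Call],
    (Regs e2 (num u) (pcode nf (pcode n s0')) 0 0 0 0, i))
  ([:: Jmp (Ev b)],
    (Regs (num_env (u :: env')) 0 (pcode n s0') 0 0 0 0, i)).
  apply: reach_jmp; rewrite /nf /=; do 10!run_cmd.
  apply: (@reach_sw _ _ rA _ _ (Regs _ _ _ (index b Tm) 0 0 0));
    first exact: map_f.
  by rewrite index_map // => p q [].
apply: (reach_trans run1); apply: (reach_trans run_f).
apply: (reach_trans run2); apply: (reach_trans run_u).
exact: (reach_trans run3).
Qed.

Lemma msubst_nil k s : msubst k [::] s = s.
Proof.
by elim: s k => [j|s1 IH1 s2 IH2|s IHs] k /=;
  rewrite ?IH1 ?IH2 ?IHs // nth_nil if_same.
Qed.

(** A fold over the input: [on_sym i] has the value accumulated so far as its variable 0. *)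
Inductive reads : term -> seq nat -> term -> Prop :=
| reads_nil t : reads t [::] t
| reads_cons t t' t'' i inp : i < nsym ->
  eval (msubst 0 [:: t] (on_sym i)) t' ->
    reads t' inp t'' -> reads t (i :: inp) t''.

Lemma reads_cat t t' t'' i j : reads t i t' -> reads t' j t'' ->
  reads t (i ++ j) t''.
Proof.
by elim=> // {}t u u' x i' xn tu _ IH /IH; apply: reads_cons xn tu.
Qed.

Hypothesis Tm_sym : forall i,
  i < nsym -> on_sym i \in Tm /\ closed_at 1 (on_sym i).
Hypothesis Tm_fin : fin \in Tm /\ closed_at 1 fin.
Hypothesis Tm_init : init \in Tm /\ closed_at 0 init.

Lemma simulate_load s l v w e inp b k :
  s \in Tm -> closed_at 1 s -> l \in returns -> wf_val v ->
  eval (msubst 0 [:: term_of v] s) w ->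
  block b = seqc (load_arg ++ push_label l) (Jmp (Ev s)) ->
  exists v' e', [/\ term_of v' = w, wf_val v' &
    creach (Jmp b :: k, (Regs e (num v) 0 0 0 0 0, inp))
      ([:: Jmp l], (Regs e' (num v') 0 0 0 0 0, inp))].
Proof.
move=> sT s_closed lr v_wf sw bE.
have env_wf u : u \in [:: v] -> wf_val u by rewrite inE => /eqP->.
have [//|v' [e' [v'w v'_wf run]]] :=
  @simulate _ _ sw s [:: v] l 0 0 inp sT s_closed env_wf lr.
exists v', e'; split=> //; apply: reach_jmp; rewrite bE /=.
do 4!run_cmd; apply: reach_sq; first exact: runs_ins.
by rewrite foldl_incr_nseq; do 3!run_cmd.
Qed.

Lemma run_reads t inp t' v e : reads t inp t' -> wf_val v -> term_of v = t ->
  exists v' e', [/\ term_of v' = t', wf_val v' &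
    creach ([:: Jmp Main], (Regs e (num v) 0 0 0 0 0, inp))
      ([:: Jmp Main], (Regs e' (num v') 0 0 0 0 0, [::]))].
Proof.
move=> tt'; elim: tt' v e =>
  {t inp t'} [t | t t' t'' j inp jn tt' _ IH] v e v_wf vt.
  by exists v, e; split=> //; apply: reach_refl.
have [sT s_closed] := Tm_sym jn; rewrite -vt in tt'.
have ret_main : Main \in returns by rewrite !inE eqxx orbT.
have [//|v1 [e1 [v1t v1_wf run1]]] :=
  @simulate_load _ Main v _ e inp (OnSym j) [::] sT s_closed ret_main v_wf tt'.
have [v2 [e2 [v2t v2_wf run2]]] := IH v1 e1 v1_wf v1t.
exists v2, e2; split=> //; apply: reach_jmp.
apply: (@reach_step _ _ _ ([:: Jmp (OnSym j)], (Regs e (num v) 0 0 0 0 0,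
  inp))).
  by rewrite /= -map_comp (nth_map 0) ?size_iota // nth_iota.
exact: reach_trans run1 run2.
Qed.

Lemma run_machine t inp t' w : eval init t -> reads t inp t' ->
  eval (msubst 0 [:: t'] fin) w ->
  exists s env m, [/\ w = lam (msubst 1 (map term_of env) s),
    wf_val (Clo s env) &
    creach ([:: Jmp Init], (Regs 0 0 0 0 0 0 0, inp))
      ([:: block (if s == yes then Yes else No)], (m, [::]))].
Proof.
move=> it tt' tw; have [iT i_closed] := Tm_init; have [fT f_closed] := Tm_fin.
have ret_main : Main \in returns by rewrite !inE eqxx orbT.
have ret_decide : Decide \in returns by rewrite !inE eqxx !orbT.
have [//||v [e [vt v_wf run]]] := @simulate _ _ it init [::] Main 0 0 inp iT
  i_closed _ ret_main.
  by rewrite msubst_nil.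
have [v1 [e1 [v1t v1_wf run1]]] := run_reads e tt' v_wf vt.
rewrite -v1t in tw.
have [//|[s env] [e2 [v2w v2_wf run2]]] :=
  @simulate_load _ Decide v1 _ e1 [::] OnEnd [::] fT f_closed ret_decide v1_wf
    tw.
exists s, env, (Regs e2 0 0 0 0 (num_env env) 0); split=> //.
apply: reach_jmp; rewrite /=.
apply: reach_sq; first exact: runs_ins.
rewrite foldl_incr_nseq; do 3!run_cmd.
apply: (reach_trans run); apply: (reach_trans run1).
apply: reach_jmp; apply: (@reach_step _ _ _ ([:: Jmp OnEnd],
  (Regs e1 (num v1) 0 0 0 0 0, [::]))) => //.
apply: (reach_trans run2); apply: reach_jmp; rewrite /=.
do 3!run_cmd.
have sT : s \in Tm by move: v2_wf; case E : _ / => [s' env' s'T _ _];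
  case: E => ->.
have lt : index s Tm < size [seq if s' == yes then Yes else No | s' <- Tm].
  by rewrite size_map index_mem.
have := @reach_sw_nth _ block rA _ No
  (Regs e2 0 0 (index s Tm) 0 (num_env env) 0) [::] lt.
rewrite /= (nth_map (var 0)) ?index_mem // nth_index // => run3.
by apply: (reach_trans run3); apply/reach_jmp/reach_refl.
Qed.

Definition labs : seq lab :=
  [:: Init; Main; OnEnd; Decide; Yes; No; Ret; Call] ++
  map OnSym (iota 0 nsym) ++ map Ev Tm ++ map Arg Tm.

Definition controls : seq (seq (cmd lab)) :=
  [::] :: [seq [:: Jmp l] | l <- labs] ++
  flatten [seq states (block l) [::] | l <- labs].

Lemma mem_labs l : l \in labs =
  match l with
  | Ev s | Arg s => s \in Tm
  | OnSym i => i < nsym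
  | _ => true
  end.
Proof.
apply/idP/idP; rewrite !mem_cat.
  case/or4P=> [|/mapP[i + ->]|/mapP[s + ->]|/mapP[s + ->]] //;
    last by rewrite mem_iota.
  rewrite !inE => /or4P[/eqP->|/eqP->|/eqP->|] //.
  by case/or4P=> [/eqP->|/eqP->|/eqP->|/orP[]/eqP->].
case: l => [s sT|s sT|||||i i_n||||] //; rewrite ?map_f ?orbT ?mem_iota //.
all: by rewrite !inE eqxx ?orbT.
Qed.

Lemma block_labs l l' : l \in labs -> l' \in labels (block l) -> l' \in labs.
Proof.
have allT s : s \in Tm -> Ev s \in labs by move=> sT; rewrite mem_labs.
have call_ret l'' : l'' \in map Ev Tm ++ returns -> l'' \in labs.
  rewrite mem_labs !mem_cat =>
    /orP[/mapP[s sT ->] // | /orP[|/mapP[s sT ->] //]].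
  by rewrite !inE => /or3P[]/eqP->.
rewrite mem_labs; case: l => [[[|j]|s t|s]|t|||||i||||] /= lT;
  rewrite ?mem_seq1 //.
- by move/eqP->; rewrite mem_labs.
- by move/eqP->; apply/allT/Tm_var.
- by have [sT tT] := Tm_app lT; move/eqP->; apply: allT.
- by move/eqP->; rewrite mem_labs.
- by move/eqP->; apply: allT.
- by move=> l'T; apply: call_ret; rewrite mem_cat l'T.
- by move=> l'R; apply: call_ret; rewrite mem_cat l'R orbT.
- by move/eqP->; apply: allT; case: Tm_init.
- by rewrite mem_labs in_cons => /predU1P[-> | /mapP[i + ->]];
    rewrite ?mem_iota.
- by move/eqP->; apply: allT; case: (Tm_sym lT).
- by move/eqP->; apply: allT; case: Tm_fin.
- by case/mapP=> s _ ->; rewrite mem_labs; case: ifP.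
Qed.

Lemma controls_closed k : k \in controls ->
  {subset succs (opof block k) <= controls}.
Proof.
have jmpC l : l \in labs -> [:: Jmp l] \in controls.
  by move=> ll; rewrite inE mem_cat map_f ?orbT.
have stC l : l \in labs -> {subset states (block l) [::] <= controls}.
  move=> ll q qs; rewrite inE mem_cat; apply/orP; right; apply/orP; right.
  by apply/flattenP; exists (states (block l) [::]) => //; apply/mapP; exists l.
rewrite inE mem_cat => /or3P[/eqP-> // | /mapP[l ll ->] q | /flattenP[_ /mapP[l
  ll ->]] ].
  by rewrite /= inE => /eqP->; apply/(stC l ll)/mem_states.
apply: states_closed; first exact: stC.
- by rewrite inE.
- by move=> l' l'l; apply/jmpC/block_labs/l'l.
- move=> l' l'l; apply: (stC l'); last exact: mem_states.
  exact: block_labs l'l.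
Qed.

End Machine.

(** * The program computing its own set of braids *)

(** A variable brings in all the smaller ones, since the machine looks up [var i.+1] by dropping an
    entry of the environment and going on with [var i]. *)
Fixpoint subterms (s : term) : seq term :=
  match s with
  | var j => [seq var i | i <- iota 0 j.+1]
  | app s1 s2 => s :: subterms s1 ++ subterms s2
  | lam s1 => s :: subterms s1
  end.

Lemma mem_subterms s : s \in subterms s.
Proof.
by case: s => [j|s1 s2|s1]; rewrite ?mem_head //; apply: map_f;
  rewrite mem_iota leqnn.
Qed.

Definition subterm_closed (ts : seq term) : Prop :=
  [/\ forall s t, app s t \in ts -> s \in ts /\ t \in ts,
      forall s, lam s \in ts -> s \in ts &
      forall j, var j.+1 \in ts -> var j \in ts].

Lemma subterm_closed_cat ts us :
  subterm_closed ts -> subterm_closed us -> subterm_closed (ts ++ us).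
Proof.
move=> [ta tl tv] [ua ul uv]; split=> [s t|s|j]; rewrite !mem_cat.
- by case/orP=> [/ta | /ua] [-> ->]; rewrite ?orbT.
- by case/orP=> [/tl | /ul] ->; rewrite ?orbT.
- by case/orP=> [/tv | /uv] ->; rewrite ?orbT.
Qed.

Lemma subterm_closed_subterms s : subterm_closed (subterms s).
Proof.
elim: s => [j|s1 [a1 l1 v1] s2 [a2 l2 v2]|s1 [a1 l1 v1]].
- split=> [s t|s|i]; try by case/mapP.
  case/mapP=> k + [Ek]; rewrite -Ek mem_iota => ij.
  by apply: map_f; rewrite mem_iota; lia.
- rewrite /=; split=> [s t|s|i]; rewrite !inE !mem_cat.
  + by case/or3P=> [/eqP[-> ->] | /a1[-> ->] | /a2[-> ->]];
      rewrite ?mem_subterms ?orbT.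
  + by case/or3P=> [/eqP // | /l1-> | /l2->]; rewrite ?orbT.
  + by case/or3P=> [/eqP // | /v1-> | /v2->]; rewrite ?orbT.
- rewrite /=; split=> [s t|s|i]; rewrite !inE.
  + by case/orP=> [/eqP // | /a1[-> ->]]; rewrite ?orbT.
  + by case/orP=> [/eqP[->] | /l1->]; rewrite ?mem_subterms ?orbT.
  + by case/orP=> [/eqP // | /v1->]; rewrite ?orbT.
Qed.

(** * Lambda-terms that prepend fixed words to the entries of an encoded list *)

Local Notation word := (braid_word 5).
Local Notation enc_word := (enc_seq (@enc_letter 5)).
Local Notation enc_words := (@enc_braid_words 5).

Lemma enc_letter_closed k (l : braid_letter 5) : closed_at k (enc_letter l).
Proof.
have nat_closed n j : closed_at j (enc_nat n) by elim: n j => //= n IHn j.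
by case: l => i b; rewrite /= !nat_closed; case: b.
Qed.

Local Opaque enc_letter.

Lemma enc_seq_closed (T : Type) (enc : T -> term) k ts :
  (forall j t, closed_at j (enc t)) -> closed_at k (enc_seq enc ts).
Proof. by move=> enc_closed; elim: ts k => //= t ts IH k;
  rewrite enc_closed IH. Qed.

Lemma enc_word_closed k w : closed_at k (enc_word w).
Proof. exact/enc_seq_closed/enc_letter_closed. Qed.

Lemma enc_words_closed k ws : closed_at k (enc_words ws).
Proof. exact/enc_seq_closed/enc_word_closed. Qed.

Lemma eval_enc_seq (T : Type) (enc : T ->
  term) ts : eval (enc_seq enc ts) (enc_seq enc ts).
Proof. by case: ts => *; apply: eval_lam. Qed.

Definition cons_term (s t : term) : term := lam (lam (app (app (var 0) s) t)).

(* The encoding of w ++ v, where the encoding of v is to be substituted for the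
   variable j. *)
Fixpoint prefix_term (w : word) (j : nat) : term :=
  if w is l :: w' then cons_term (enc_letter l) (prefix_term w' j.+2) else var
    j.

Lemma prefix_term_closed k w j : j < k -> closed_at k (prefix_term w j).
Proof. by elim: w k j => //= l w IHw k j jk; rewrite enc_letter_closed IHw. Qed.

Lemma subst_prefix v k w :
  subst (enc_word v) k (prefix_term w k) = enc_word (w ++ v).
Proof.
elim: w k => [|l w IHw] k /=; first by rewrite eqxx.
by rewrite (subst_closed _ (enc_letter_closed _ _)) IHw.
Qed.

Lemma subst_prefix_neq u k w j : j <> k ->
  subst u k (prefix_term w j) = prefix_term w j.
Proof.
elim: w k j => [|l w IHw] k j jk /=; first by case: eqP.
by rewrite (subst_closed _ (enc_letter_closed _ _)) IHw //; case.
Qed.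

(* Scott lists are their own case analysis; the first argument is the value for
   the empty list, which is never used. *)
Definition uncons (s t : term) :
  term := app (app s (lam (var 0))) (lam (lam t)).

Lemma eval_uncons s h t b w : closed_at 0 h -> closed_at 0 t -> eval h h ->
  eval t t ->
  eval s (cons_term h t) -> eval (subst t 0 (subst h 1 b)) w ->
    eval (uncons s b) w.
Proof.
move=> h_closed t_closed hh tt sht btw.
have sub u k r : closed_at 0 r -> subst u k r = r.
  by move=> r_closed; apply/subst_closed/(closed_at_le (leq0n k) r_closed).
apply: (@eval_app _ _ (app (app (var 0) h) t) (lam (lam b)) w).
- apply: (eval_app sht (eval_lam _)).
  by rewrite /= (sub _ _ h) // (sub _ _ t) //; apply: eval_lam.
- exact: eval_lam.
rewrite /= (sub _ _ h) // (sub _ _ t) //; apply: (eval_app _ tt btw).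
exact: (eval_app (eval_lam (lam b)) hh (eval_lam (subst h 1 b))).
Qed.

Definition high_letter (c : nat) : word := flatten (map high (word_bits [:: 0;
  c])).

Definition high_word (u : seq nat) :
  word := flatten (map high (word_bits (sep_before u))).

Definition macro (i : nat) : word :=
  nth [::] [:: low false; low true; high false; high true] i.

(** After both case analyses the variables 3, 1 and 0 are the first entry, the second entry and the
    remaining list. Each [cons_term] shifts by two, so they become 5 under one [cons_term], and 5
    and 4 under two. *)
Definition push_words (u v : word) : term :=
  uncons (var 0) (uncons (var 0)
    (cons_term (prefix_term u 5) (cons_term (prefix_term v 5) (var 4)))).

Definition push_new (u : word) : term :=
  uncons (var 0)
    (cons_term (prefix_term u 3) (cons_term (enc_word [::]) (var 4))).

Definition push_head (u : word) : term :=
  uncons (var 0) (cons_term (prefix_term u 3) (var 2)).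

Lemma push_words_closed u v : closed_at 1 (push_words u v).
Proof. by rewrite /= !prefix_term_closed. Qed.

Lemma push_new_closed u : closed_at 1 (push_new u).
Proof. by rewrite /= !prefix_term_closed. Qed.

Lemma push_head_closed u : closed_at 1 (push_head u).
Proof. by rewrite /= !prefix_term_closed. Qed.

Lemma msubst_closed_id k us s : closed_at k s -> msubst k us s = s.
Proof.
elim: s k => [j|s1 IH1 s2 IH2|s IHs] k /=.
- by move->.
- by move=> /andP[/IH1-> /IH2->].
- by move/IHs->.
Qed.

Lemma msubst_uncons t b : closed_at 2 b ->
  msubst 0 [:: t] (uncons (var 0) b) = uncons t b.
Proof. by move=> b_closed; rewrite /= msubst_closed_id. Qed.

Lemma subst_enc_word r k w : subst r k (enc_word w) = enc_word w.
Proof. exact/subst_closed/enc_word_closed. Qed.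

Lemma eval_uncons_words h ws b r :
  eval (subst (enc_words ws) 0 (subst (enc_word h) 1 b)) r ->
  eval (uncons (enc_words (h :: ws)) b) r.
Proof.
exact: (eval_uncons (enc_word_closed 0 h) (enc_words_closed 0 ws)
  (eval_enc_seq _ _) (eval_enc_seq _ _) (eval_lam _)).
Qed.

Lemma eval_push_words u v h w ws :
  eval (msubst 0 [:: enc_words [:: h, w & ws]] (push_words u v))
    (enc_words [:: u ++ h, v ++ w & ws]).
Proof.
rewrite msubst_uncons; last by rewrite /= !prefix_term_closed.
apply: eval_uncons_words.
rewrite /= subst_prefix subst_prefix_neq // subst_enc_word subst_prefix_neq //.
apply: eval_uncons_words.
rewrite /= !subst_enc_word subst_prefix subst_enc_word; exact: eval_lam.
Qed.

Lemma eval_push_new u h ws :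
  eval (msubst 0 [:: enc_words (h :: ws)] (push_new u))
    (enc_words [:: u ++ h, [::] & ws]).
Proof.
rewrite msubst_uncons; last by rewrite /= !prefix_term_closed.
apply: eval_uncons_words.
rewrite /= subst_prefix subst_enc_word; exact: eval_lam.
Qed.

Lemma eval_push_head u h ws :
  eval (msubst 0 [:: enc_words (h :: ws)] (push_head u)) (enc_words ((u ++
    h) :: ws)).
Proof.
rewrite msubst_uncons; last by rewrite /= !prefix_term_closed.
apply: eval_uncons_words.
rewrite /= subst_prefix subst_enc_word; exact: eval_lam.
Qed.

(** The symbols 0 to 3 prepend a generator word to the braid word under construction, and 4 opens a
    new one. Every symbol also records its own letter in the head of the list, where the
    input-dependent start tile grows. *)
Definition on_sym (i : nat) : term :=
  let u := high_letter (letter_of_sym i) in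
  if i == 4 then push_new u else push_words u (macro i).

Definition start_prefix : word :=
  flatten (map low (word_bits [:: 0])) ++ flatten (map high (word_bits [:: 1])).

(** 3 is the marker and 16 the letter of the initial state: the end of the word of every initial
    configuration. *)
Definition init : term := enc_words [:: high_word [:: 3; 16]].

Definition fin (D : term) : term := app D (push_head start_prefix).

Lemma high_word_cons c u : high_word (c :: u) = high_letter c ++ high_word u.
Proof.
rewrite /high_word /high_letter -flatten_cat -map_cat.
by rewrite -word_bits_cat.
Qed.

Lemma pair_word_start u :
  pair_word ([:: 0], 1 :: sep_before u) = start_prefix ++ high_word u.
Proof.
rewrite /pair_word /bits_word -[1 :: _]cat1s word_bits_cat map_cat flatten_cat.
by rewrite catA.
Qed.

Lemma pair_word_macros p : exists2 ms, all (fun i => i < 4) ms &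
  pair_word p = flatten (map macro ms).
Proof.
rewrite /pair_word; move: (word_bits p.1) (word_bits p.2) => s t.
exists (map nat_of_bool s ++ [seq 2 + b | b : bool <- t]).
  by rewrite all_cat !all_map; apply/andP; split; apply/allP => -[].
rewrite map_cat flatten_cat -!map_comp /bits_word /=.
by congr (_ ++ _); congr flatten; apply/eq_map; case.
Qed.

(** Since symbols prepend, a word is fed from its last macro to its first; the head of the list then
    records the letters in the order of [ms]. *)
Lemma reads_macros ms u w ws : all (fun i => i < 4) ms ->
  reads on_sym 5 (enc_words [:: high_word u, w & ws]) (rev ms)
    (enc_words [:: high_word (map letter_of_sym ms ++ u),
      flatten (map macro ms) ++ w & ws]).
Proof.
elim: ms => [|m ms IHms] /=; first by move=> _; apply: reads_nil.
move=> /andP[m4 /IHms{}IHms]; rewrite rev_cons -cats1.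
apply: reads_cat IHms _; apply: reads_cons (reads_nil _ _ _); first exact: ltnW.
rewrite high_word_cons /on_sym ltn_eqF // -catA; exact: eval_push_words.
Qed.

Lemma reads_words ws u :
  (forall w, w \in ws -> exists2 ms, all (fun i =>
    i < 4) ms & w = flatten (map macro ms)) ->
  exists2 inp, all (fun i => i < 5) inp &
    reads on_sym 5 (enc_words [:: high_word u]) inp
      (enc_words (high_word (rev (map letter_of_sym inp) ++ u) :: ws)).
Proof.
elim: ws => [|w ws IHws] ws_ok; first by exists [::]; rewrite //;
  apply: reads_nil.
have [|inp inp5 IH] := IHws; first by move=> v vs; apply: ws_ok;
  rewrite inE vs orbT.
have [ms ms4 ->] := ws_ok w (mem_head _ _).
exists (inp ++ 4 :: rev ms).
  by rewrite all_cat inp5 /= all_rev (sub_all _ ms4) // => i /ltnW.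
apply: reads_cat IH _; apply: reads_cons; first by [].
  by rewrite /on_sym eqxx; apply: eval_push_new.
rewrite -high_word_cons map_cat rev_cat /= rev_cons map_rev revK cat_rcons.
by have := reads_macros (letter_of_sym 4 :: rev (map letter_of_sym inp) ++
  u) [::] ws ms4;
  rewrite cats0 -catA.
Qed.

(** * Acceptance by a queue machine against the code property of its tiles *)

Section QueueTiles.

Variables (Q : eqType) (delta : Q -> nat -> option (seq nat * Q)).
Variables (al : seq nat) (base : nat) (Qs : seq Q) (qa : Q).
Hypothesis al_ok : forall x, x \in al -> 2 < x < base.
Hypothesis base_ok : 2 < base.
Hypothesis qa_in : qa \in Qs.
Hypothesis delta_qa : forall x, delta qa x = None.
Hypothesis delta_ok : forall q x w q', q \in Qs -> x \in al ->
  delta q x = Some (w, q') -> q' \in Qs /\ {subset w <= al}.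
Variable c0 : Q * seq nat.
Hypotheses (c0_Q : c0.1 \in Qs) (c0_al : {subset c0.2 <= al}).

Let rules := queue_rules delta al base Qs qa.
Let T := tiles rules (conf_word base Qs c0) (state_letter base Qs qa).

Lemma c0_rotated_ok :
  (conf_word base Qs c0 != [::]) && all (leq 3) (conf_word base Qs c0).
Proof. exact: (rotated_ok al_ok qa_in delta_ok base_ok c0_Q c0_al (rotated_c0 _
  _ _ _)). Qed.

Lemma accept_not_code d : reach (qstep delta) c0 d -> d.1 = qa -> ~ is_code T.
Proof.
move=> c0d d_qa codeT; have /andP[u_n0 _] := c0_rotated_ok.
have rules_ok r := @queue_rules_ok _ _ _ _ _ _ al_ok qa_in delta_qa delta_ok
  base_ok r.
have steps := accept_steps base qa_in delta_qa delta_ok c0d d_qa c0_Q c0_al.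
have [ps [qs [psT qsT eq1 eq2]]] := post_match (conf_word base Qs c0) rules_ok
  steps u_n0.
(* The two start tiles in front turn the match for the initial word into two factorizations that
   differ in their first tile. *)
suff: ([:: 0], 1 :: sep_before (conf_word base Qs c0)) :: ps = ([:: 0], [:: 1;
  0]) :: qs.
  by case=> + _; case: (conf_word _ _ _) u_n0 => // c [].
apply: codeT => //.
- by move=> p; rewrite inE => /predU1P[-> | /psT //]; rewrite mem_head.
- by move=> p; rewrite inE => /predU1P[-> | /qsT //]; rewrite !inE eqxx orbT.
- by rewrite /= eq1.
- by rewrite /= -/(flat ps) -/(flat qs) -eq2 sep_before_pending.
Qed.

Lemma reject_code d : reach (qstep delta) c0 d -> qstep delta d = None ->
  d.1 != qa ->
  (forall c, reach (qstep delta) c0 c -> c.2 != [::]) -> is_code T.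
Proof.
move=> c0d d_final d_qa c_n0 ps qs _ _ psT qsT eq1 eq2.
have reach_c0 c : reach (qstep delta) c0 c -> c.1 != qa /\ c.2 != [::].
  move=> c0c; split; last exact: c_n0.
  (* An accepting configuration is stuck, so by determinism it would be the final configuration
     [d]. *)
  apply: contraNneq d_qa => c_qa; rewrite -c_qa.
  rewrite (reach_stuck _ (reach_final c0d c0c d_final)) //.
  by rewrite /qstep c_qa; case: (c.2) => // x v; rewrite delta_qa.
have rules_ok r := @queue_rules_ok _ _ _ _ _ _ al_ok qa_in delta_qa delta_ok
  base_ok r.
have [//|] := tiles_code rules_ok c0_rotated_ok (rotated_c0 delta base Qs c0)
  (rotated_step al_ok qa_in delta_qa delta_ok c0_Q c0_al reach_c0)
  (rotated_size qa_in delta_qa base_ok c0_Q reach_c0)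
  (rotated_ok al_ok qa_in delta_ok base_ok c0_Q c0_al) psT qsT eq1 eq2.
by move/(rotated_halt qa_in base_ok c0_Q reach_c0).
Qed.

End QueueTiles.

(** The marker is written back whenever it is read; hence the queue never becomes empty, as
    [reject_code] demands. *)
Lemma hash_reach (L : eqType) (block : L -> cmd L) c d :
  reach (qstep (delta block)) c d -> 3 \in c.2 -> 3 \in d.2.
Proof.
elim=> {c d} // -[q [|x v]] c' d //;
  rewrite /qstep [X in if X is Some _ then _ else _]/=.
move=> + _ IHd xv; case Ed: (delta _ _ _) => [[w q']|] // [Ec']; apply: IHd.
rewrite -Ec' mem_cat; move: xv; rewrite inE => /predU1P[Ex|->//]; subst x.
suff -> : 3 \in w by rewrite orbT.
move: Ed; rewrite /delta; case: q => -[] k;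
  case: (opof block k) => //= [w0 q0|r k1 k2|ks k0] [<- _];
  exact: mem_head.
Qed.

(** The machine tests only the body of the resulting closure. No part of this body can come from the
    environment, because [lam (var 1)] and [var 1] are not closed while the values are. *)
Lemma true_body us s : (forall u, u \in us -> closed_at 0 u) ->
  lam (msubst 1 us s) = enc_bool true -> s = lam (var 1).
Proof.
move=> us_closed; case: s => [j|//|s] /= [].
  case: (ltnP j 1) => // j1 Ej; have := us_closed (nth (var j) us (j - 1)).
  have [/mem_nth -> /(_ isT)|/(nth_default (var j)) Ej' _] := ltnP (j - 1)
    (size us).
    by rewrite Ej.
  by rewrite Ej' in Ej.
case: s => [j|//|//] /=; case: (ltnP j 2) => [_ [->] //| j2 Ej].
have := us_closed (nth (var j) us (j - 2)).
have [/mem_nth -> /(_ isT)|/(nth_default (var j)) Ej' _] := ltnP (j - 2) (size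
  us).
  by rewrite Ej.
by move: j2; rewrite Ej' in Ej; case: Ej => ->.
Qed.

Lemma index_head (T : eqType) (x : T) s : index x (x :: s) = 0.
Proof. by rewrite /= eqxx. Qed.

(** * The machine that applies a given decision procedure to its own tiles *)

Section Diagonal.

Variable D : term.
Hypothesis D_closed : closed_at 0 D.

Definition program_terms : seq term :=
  subterms init ++ flatten [seq subterms (on_sym i) | i <- iota 0 5] ++
  subterms (fin D).

Local Notation Tm := program_terms.
Local Notation yes := (lam (var 1)).

Lemma program_subterms : subterm_closed Tm.
Proof.
apply: subterm_closed_cat; first exact: subterm_closed_subterms.
apply: subterm_closed_cat; last exact: subterm_closed_subterms.
elim: (iota 0 5) => [|i js IH] /=; first by split.
by apply: subterm_closed_cat IH; apply: subterm_closed_subterms.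
Qed.

Lemma init_program : init \in Tm /\ closed_at 0 init.
Proof.
split; last exact: enc_words_closed.
by rewrite mem_cat mem_subterms.
Qed.

Lemma fin_program : fin D \in Tm /\ closed_at 1 (fin D).
Proof.
split; first by rewrite !mem_cat mem_subterms !orbT.
rewrite -[closed_at 1 _]/(closed_at 1 D &&
  closed_at 1 (push_head start_prefix)).
by rewrite push_head_closed (closed_at_le (leq0n 1) D_closed).
Qed.

Lemma on_sym_program i : i < 5 -> on_sym i \in Tm /\ closed_at 1 (on_sym i).
Proof.
move=> i5; split.
  rewrite mem_cat [X in _ || X]mem_cat; apply/orP; right; apply/orP; left.
  apply/flattenP.
  exists (subterms (on_sym i)); last exact: mem_subterms.
  by apply/mapP; exists i; rewrite // mem_iota.
by rewrite /on_sym; case: ifP => _;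
  [apply: push_new_closed | apply: push_words_closed].
Qed.

Local Notation blk := (block Tm init (fin D) on_sym yes 5).
Local Notation start_state := (false, [:: Jmp Init]).
Local Notation yes_state := (false, [:: blk Yes]).

(* The initial state is put first so that its letter, 16, can be written in
   [init] before the states are known. *)
Definition program_states : seq (bool * seq (cmd lab)) :=
  start_state :: queue_states (controls Tm init (fin D) on_sym yes 5).

Local Notation Qs := program_states.

Lemma mem_program_states q :
  (q \in Qs) = (q \in queue_states (controls Tm init (fin D) on_sym yes 5)).
Proof.
rewrite inE; case: eqP => //= ->; apply/esym; rewrite mem_queue_states.
rewrite inE mem_cat; apply/orP; right; apply/orP; left.
by apply/mapP; exists Init; rewrite ?mem_labs.
Qed.

Lemma yes_program : yes_state \in Qs.
Proof.
rewrite mem_program_states mem_queue_states inE mem_cat.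
apply/orP; right; apply/orP; right; apply/flattenP.
by exists (states (blk Yes) [::]); [apply/mapP; exists Yes;
  rewrite ?mem_labs | apply: mem_states].
Qed.

Lemma delta_program q x w q' : q \in Qs -> x \in alphabet ->
  delta blk q x = Some (w, q') -> q' \in Qs /\ {subset w <= alphabet}.
Proof.
rewrite !mem_program_states; have [ta tl tv] := program_subterms.
apply: delta_closed => k.
exact: controls_closed ta tv on_sym_program fin_program init_program k.
Qed.

Lemma start_letter : state_letter 16 Qs start_state = 16.
Proof. by rewrite /state_letter /program_states index_head. Qed.

Lemma delta_yes x : delta blk yes_state x = None.
Proof. by []. Qed.

Definition program_rules := queue_rules (delta blk) alphabet 16 Qs yes_state.

Definition program_tiles :=
  other_tiles program_rules (state_letter 16 Qs yes_state).

End Diagonal.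

Lemma eval_lam_inv s v : eval (lam s) v -> v = lam s.
Proof. by move E: (lam s) => t tv; case: tv E. Qed.

Lemma represents_input inp : all (fun i => i < 5) inp ->
  represents (3 :: map letter_of_sym inp) (Regs 0 0 0 0 0 0 0, inp).
Proof.
move=> inp5; exists (map letter_of_sym inp), [::]; rewrite cats0.
have small x : x \in map letter_of_sym inp -> 3 < x < 9.
  by case/mapP=> s /(allP inp5) s5 ->; rewrite /letter_of_sym; lia.
split=> // [x /small|r|].
- by rewrite -[behead alphabet]/(iota 4 12) mem_iota; lia.
- rewrite (count_memPn _); first by case: r.
  by apply/negP=> /small; case: r.
- by apply/all_filterP/allP.
Qed.

(* A finite set of braids is given by a list of words representing its
   elements. *)
Theorem theorem4 :
  ~ algorithmically_decidable (@enc_braid_words 5)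
      (fun ws : seq (braid_word 5) =>
         free_semigroup [fset braid_of w | w in ws]%fset).
Proof.
case=> D D_closed decD.
(* These words depend on [D] only, not on the input, so the input can be chosen afterwards as a
   description of them. *)
pose F := map pair_word (program_tiles D).
have [|inp inp5 reads_inp] := @reads_words F [:: 3; 16].
  by move=> _ /mapP[p _ ->]; apply: pair_word_macros.
(* [u] is exactly the word of the initial configuration on [inp], as [conf_start] checks; so the
   list built by the machine encodes the tiles of its own run. *)
set u := rev _ ++ _ in reads_inp.
pose I := (start_prefix ++ high_word u) :: F.
pose T := ([:: 0], 1 :: sep_before u) :: program_tiles D.
have EI : I = map pair_word T by rewrite /T map_cons pair_word_start.
(* Under call by value the argument [push_head start_prefix] is first evaluated to the encoding of
   [I], so the answer of [D] is unchanged. *)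
have eval_fin b : eval (app D (enc_braid_words I)) (enc_bool b) ->
    eval (msubst 0 [:: enc_braid_words (high_word u :: F)] (fin D))
      (enc_bool b).
  have -> t : msubst 0 [:: t] (fin D) =
      app D (msubst 0 [:: t] (push_head start_prefix)).
    by congr app; apply: msubst_closed_id.
  move E: (app _ _) => t tb; case: tb E => // s t' s' v w ss tt' sw [Es Et].
  rewrite -Es in ss; rewrite -Et in tt'.
  have Ev : v = enc_braid_words I by apply: eval_lam_inv tt'.
  rewrite Ev in sw; apply: (eval_app ss _ sw); exact: eval_push_head.
pose v0 := 3 :: map letter_of_sym inp.
have v0_rep := represents_input inp5.
have [ta tl tv] := program_subterms D.
have run b : eval (app D (enc_braid_words I)) (enc_bool b) -> _ :=
  fun Db => run_machine (lam (var 1)) ta tl (@on_sym_program D)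
   (fin_program D_closed) (init_program D) (eval_enc_seq _ _) reads_inp
     (eval_fin b Db).
have start_al : {subset v0 <= alphabet}.
  move=> x; rewrite inE => /predU1P[-> // | /mapP[s /(allP inp5) s5 ->]].
  by rewrite mem_iota /letter_of_sym; lia.
have al_ok x : x \in alphabet -> 2 < x < 16 by rewrite mem_iota; lia.
have conf_start :
    conf_word 16 (program_states D) (false, [:: Jmp Init], v0) = u.
  by rewrite /conf_word start_letter /v0 rev_cons cat_rcons.
have start_in : (false, [:: Jmp Init]) \in program_states D by rewrite mem_head.
have free_T : free_semigroup [fset braid_of w | w in I]%fset <-> is_code T.
  by rewrite EI; apply: free_pair_words.
have TE : T = tiles (program_rules D)
  (conf_word 16 (program_states D) (false, [:: Jmp Init], v0))
  (state_letter 16 (program_states D) (false,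
    [:: block (program_terms D) init (fin D) on_sym (lam (var 1)) 5 Yes])).
  by rewrite conf_start.
have [free | not_free] := pselect (free_semigroup [fset braid_of w | w in
  I]%fset).
- have [s [env [m [Es clo_wf]]]] := run true ((decD I).1 free).
  have env_wf v : v \in env -> wf_val (program_terms D) v.
    by case E : _ / clo_wf => [s' env' _ _ wf]; case: E => _ ->; apply: wf.
  rewrite (true_body (term_of_closed env_wf) (esym Es)) eqxx => run_yes.
  have [v' _ qrun] := queue_run run_yes v0_rep.
  have := accept_not_code (c0 := (false, [:: Jmp Init], v0)) al_ok isT
    (yes_program D) (@delta_yes D) (@delta_program D D_closed) start_in
      start_al qrun erefl.
  by rewrite -/(program_rules D) -TE => /(_ (free_T.1 free)).
- have [s [env [m [Es _]]]] := run false ((decD I).2 not_free).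
  (* The body [lam (var 1)] would make the answer the encoding of true. Otherwise the run ends in
     [Sw rA [::]], which is stuck but different from the accepting [Acc]. *)
  case: eqP => [Es' | _ run_no]; first by rewrite Es' in Es.
  have [v' v'_rep qrun] := queue_run run_no v0_rep.
  apply/not_free/free_T; rewrite TE.
  have := reject_code (c0 := (false, [:: Jmp Init], v0)) al_ok isT
    (yes_program D) (@delta_yes D) (@delta_program D D_closed) start_in
      start_al qrun.
  apply.
  + by case: (v').
  + by apply/eqP.
  + by move=> c /hash_reach/(_ (mem_head _ _)); case: (c.2).
Qed.
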